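(* Let $\mathbf D=\mathbf D(k,\pi_\bullet)$ be a generalized divided power algebra over a noetherian commutative ring $k$. Assume $k$ is complete with respect to an ideal $I$ that contains $\pi_n$ for infinitely many $n$. Let $M$ and $T$ be graded $\mathbf D$-modules, with $M$ finitely presented and $T$ torsion. Then $\underline{\mathrm{Ext}}^i_{\mathbf D}(T,M)=0$ for all $i\ge0$.
   Context: $\pi$-sequences. A $\pi$-sequence in $k$ is a sequence $(\pi_n)_{n\ge2}$ in $k$, with $\pi_1=0$. For integers $j\ge1$ and $n,m\ge0$ put $\epsilon_j(n,m)=\lfloor (n+m)/j\rfloor-\lfloor n/j\rfloor-\lfloor m/j\rfloor$, and $C(n,m)=\prod_{j\ge2}\pi_j^{\epsilon_j(n-m,m)}$. The sequence is admissible if, whenever $(\pi_n,\pi_m)\ne k$, $n\mid m$ or $m\mid n$. GDPAs. $\mathbf D(k,\pi_\bullet)$ is the graded $k$-algebra free on basis $x^{[i]}$ ($\deg x^{[i]}=i$) with $x^{[n-m]}x^{[m]}=C(n,m)x^{[n]}$. A GDPA is such an algebra with $\pi_\bullet$ admissible. Torsion. An element $m$ of a $\mathbf D$-module is torsion if $x^{[n]}m=0$ for all $n\gg0$. A module is torsion if all its elements are torsion. $\underline{\mathrm{Ext}}$ denotes the derived functors, in the category of graded $\mathbf D$-modules, of $\underline{\mathrm{Hom}}(M,N)=\bigoplus_n\underline{\mathrm{Hom}}(M,N)_n$, where $\underline{\mathrm{Hom}}(M,N)_n$ is the set of degree-preserving maps $M[n]\to N$. *)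

(* Defs.v *)
From HB Require Import structures.
From mathcomp Require Import all_boot all_order all_algebra.
Set Implicit Arguments. Unset Strict Implicit. Unset Printing Implicit Defensive.
Import Order.TTheory GRing.Theory Num.Theory.
Local Open Scope ring_scope.

Section GDPA.
Variable k : comPzRingType.

Definition is_ideal (J : k -> Prop) : Prop :=
  [/\ J 0, (forall x y, J x -> J y -> J (x + y)) & (forall a x, J x -> J (a * x))].

Definition ideal_fg (J : k -> Prop) : Prop :=
  exists (n : nat) (g : 'I_n -> k),
    forall x, J x <-> exists c : 'I_n -> k, x = \sum_(i < n) c i * g i.

Definition noetherian : Prop :=
  forall J : k -> Prop, is_ideal J -> ideal_fg J.

Fixpoint ideal_pow (J : k -> Prop) (n : nat) : k -> Prop :=
  match n with
  | O => fun _ => True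
  | S n' => fun x => exists (m : nat) (a b : 'I_m -> k),
              (forall i, J (a i) /\ ideal_pow J n' (b i)) /\ x = \sum_(i < m) a i * b i
  end.

Definition adically_complete (J : k -> Prop) : Prop :=
  (forall x, (forall n, ideal_pow J n x) -> x = 0) /\
  (forall a : nat -> k, (forall n, ideal_pow J n (a n.+1 - a n)) ->
     exists L, forall n, ideal_pow J n (L - a n)).

(* A pi-sequence is pi : nat -> k; only the values pi n, n >= 2 matter, pi 1 = 0. *)

Definition eps (j a b : nat) : nat := ((a + b) %/ j - a %/ j - b %/ j)%N.

(* C(n,m) = prod_{j>=2} pi_j^{eps_j(n-m,m)}; for m <= n the factors with j > n are 1 *)
Definition Ccoef (pi : nat -> k) (n m : nat) : k :=
  \prod_(2 <= j < n.+1) pi j ^+ eps j (n - m) m.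

Definition pi_seq (pi : nat -> k) : Prop := pi 1%N = 0.

Definition admissible (pi : nat -> k) : Prop :=
  pi_seq pi /\
  forall n m : nat, (0 < n)%N -> (0 < m)%N ->
    ~ (exists a b : k, a * pi n + b * pi m = 1) -> (n %| m)%N || (m %| n)%N.

(* coefficient of x^[f-e] x^[e-d] = C(f-d, e-d) x^[f-d]   (for d <= e <= f) *)
Definition xcoef (pi : nat -> k) (d e f : int) : k := Ccoef pi (absz (f - d)) (absz (e - d)).

(* A (Z-)graded D(k,pi)-module: components M_d (k-modules), and
   gact d e = multiplication by x^[e-d] : M_d -> M_e (zero if e < d). Since D is
   free on the x^[i] with x^[i]x^[j] = C(i+j,j) x^[i+j] and x^[0] = 1, this is
   exactly a graded D-module. *)
Unset Implicit Arguments.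
Record gmod (pi : nat -> k) := GMod {
  gcomp :> int -> lmodType k;
  gact : forall d e : int, gcomp d -> gcomp e;
  gact_add : forall d e a (u v : gcomp d), gact d e (a *: u + v) = a *: gact d e u + gact d e v;
  gact_neg : forall d e (v : gcomp d), e < d -> gact d e v = 0;
  gact_id : forall d (v : gcomp d), gact d d v = v;
  gact_comp : forall d e f (v : gcomp d), d <= e -> e <= f ->
     gact e f (gact d e v) = xcoef pi d e f *: gact d f v
}.
Set Implicit Arguments.
Arguments gact [pi].

Variable pi : nat -> k.

Unset Implicit Arguments.
Record ghom (A B : gmod pi) := GHom {
  ghfun :> forall d, A d -> B d;
  ghlin : forall d a (u v : A d), ghfun d (a *: u + v) = a *: ghfun d u + ghfun d v;
  ghcomm : forall d e (v : A d), ghfun e (gact A d e v) = gact B d e (ghfun d v)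
}.
Set Implicit Arguments.
Arguments ghfun [A B].

Definition is_hom_shift (A B : gmod pi) (s : int) (phi : forall d, A (d + s) -> B d) : Prop :=
  (forall d a (u v : A (d + s)), phi d (a *: u + v) = a *: phi d u + phi d v) /\
  (forall d e (v : A (d + s)), phi e (gact A (d + s) (e + s) v) = gact B d e (phi d v)).

Definition ginjective (E : gmod pi) : Prop :=
  forall (A B : gmod pi) (j : ghom A B) (f : ghom A E),
    (forall d, injective (j d)) ->
    exists g : ghom B E, forall d (v : A d), g d (j d v) = f d v.

Definition inj_resolution (M : gmod pi) (I : nat -> gmod pi)
   (e : ghom M (I 0%N)) (dd : forall n, ghom (I n) (I n.+1)) : Prop :=
  [/\ (forall n, ginjective (I n)),
      (forall d, injective (e d)),
      (forall d (v : I 0%N d), dd 0%N d v = 0 <-> exists u, v = e d u) &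
      (forall n d (v : I n.+1 d), dd n.+1 d v = 0 <-> exists u, v = dd n d u)].

(* underline-Ext^i(T,M) = 0 : for any injective resolution I of M, the complex
   underline-Hom(T, I^.) = (+)_s Hom(T[s], I^.) has zero cohomology in degree i,
   i.e. each summand Hom(T[s], I^.) is exact in degree i. *)
Definition ExtD_zero (T M : gmod pi) (i : nat) : Prop :=
  forall (I : nat -> gmod pi) (e : ghom M (I 0%N)) (dd : forall n, ghom (I n) (I n.+1)),
    inj_resolution e dd ->
    forall s : int,
    match i with
    | O => forall phi : forall d, T (d + s) -> I 0%N d,
             is_hom_shift phi -> (forall d v, dd 0%N d (phi d v) = 0) ->
             forall d v, phi d v = 0
    | S n => forall phi : forall d, T (d + s) -> I n.+1 d,
             is_hom_shift phi -> (forall d v, dd n.+1 d (phi d v) = 0) ->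
             exists psi : forall d, T (d + s) -> I n d,
               is_hom_shift psi /\ forall d v, phi d v = dd n d (psi d v)
    end.

Definition gtorsion (T : gmod pi) : Prop :=
  forall d (t : T d), exists N : nat, forall n : nat, (N <= n)%N -> gact T d (d + n%:Z) t = 0.

(* finitely presented graded module: homogeneous generators g_j (degree deg j),
   and the graded module of relations (submodule of (+)_j D(-deg j)) is generated
   by finitely many homogeneous relations rho_l (degree fdeg l).
   An element of degree e of (+)_j D(-deg j) is c : 'I_r -> k meaning
   sum_j c_j x^[e - deg j] e_j (with c_j = 0 when e < deg j). *)
Definition gfin_pres (M : gmod pi) : Prop :=
  exists (r : nat) (deg : 'I_r -> int) (g : forall j, M (deg j)),
    (forall e (v : M e), exists c : 'I_r -> k,
        v = \sum_(j < r) c j *: gact M (deg j) e (g j)) /\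
    exists (s : nat) (fdeg : 'I_s -> int) (rho : 'I_s -> 'I_r -> k),
      (forall l, (forall j, fdeg l < deg j -> rho l j = 0) /\
                 \sum_(j < r) rho l j *: gact M (deg j) (fdeg l) (g j) = 0) /\
      (forall e (c : 'I_r -> k),
         (forall j, e < deg j -> c j = 0) ->
         \sum_(j < r) c j *: gact M (deg j) e (g j) = 0 ->
         exists b : 'I_s -> k,
           forall j, c j = \sum_(l < s | (deg j <= fdeg l) && (fdeg l <= e))
                              b l * rho l j * xcoef pi (deg j) (fdeg l) e).

End GDPA.

(* Main.v *)
Require Import Defs.
From HB Require Import structures.
From mathcomp Require Import all_boot all_order all_algebra.
From mathcomp Require Import boolp zify ring.
Set Implicit Arguments. Unset Strict Implicit. Unset Printing Implicit Defensive.
Import Order.TTheory GRing.Theory Num.Theory.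
Local Open Scope ring_scope.

(** Write x_i for x^[i]. Call N good if every pi_j with j neither a divisor nor a multiple
of N is a unit; then D is free over the span E_N of the x_(qN), on the x_b with b < N. Since
[I] lies in the Jacobson radical, admissibility makes every N > 1 with pi_N in [I] good, and
these N form an infinite chain under divisibility.

Ext_D(D/D_{>=N}, X) is computed by the bar cochains of E_N with values in X ([acyclic N]).
Resolving X by relatively injective modules and filtering D/D_{>=N} by copies of k shows
that if Ext(D/D_{>=N}, X) vanishes in all degrees then so does Ext(k, X)
([acyclic_change]).

For M finitely presented and N divisible by n large levels, a product x_i x_j that carries
past a multiple of N has its coefficient in I^n, whenever i is at most the size of the
relations of M. Hence M/I^n M is extended from k over E_N. Over a further level m, such a
module looks, up to degree about m, like a coinduced module, because
D_i x D_{m-1-i} -> D_{m-1} is a perfect pairing; this gives contracting homotopies valid up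
to degree m, and letting m grow, Ext(k, M/I^n M) = 0. The components of M are I-adically
complete, so Ext(k, M) = 0 follows by a limit argument.

Finally, for an injective resolution J of M, the vanishing of Ext(k, M) makes the complex of
torsion parts of J exact. These torsion parts are injective for torsion modules, so that
complex is contractible, and Hom(T, J) is exact for every torsion T. *)

(** * Powers of the ideal and units of k *)

Section Ideals.
Variable k : comPzRingType.
Variable I : k -> Prop.
Hypothesis idI : is_ideal I.

Lemma ideal_powD n x y : ideal_pow I n x -> ideal_pow I n y -> ideal_pow I n (x + y).
Proof.
case: n => [//|n] [m [a [b [ab ->]]]] [m' [a' [b' [ab' ->]]]].
exists (m + m')%N, (fun i => match split i with inl i => a i | inr i => a' i end),
  (fun i => match split i with inl i => b i | inr i => b' i end); split.
  by move=> i; case: (split i).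
rewrite big_split_ord /=; congr (_ + _); apply: eq_bigr => i _.
- by case: splitP => j /= ij; [rewrite (val_inj ij) | have := ltn_ord i; lia].
- by case: splitP => j /= ij; [have := ltn_ord j; lia | have -> : i = j by apply: val_inj => /=; lia].
Qed.

Lemma ideal_powM n x y : ideal_pow I n x -> ideal_pow I n (y * x).
Proof.
case: n => [//|n] [m [a [b [ab ->]]]].
exists m, (fun i => y * a i), b; split=> [i|].
  by have [Ia ?] := ab i; split=> //; case: idI => _ _; apply.
by rewrite mulr_sumr; apply: eq_bigr => i _; rewrite mulrA.
Qed.

Lemma ideal_pow0 n : ideal_pow I n 0.
Proof.
case: n => [//|n]; exists 0%N, (fun _ => 0), (fun _ => 0).
by split=> [[]//|]; rewrite big_ord0.
Qed.

Lemma ideal_pow_sum n (T : Type) (r : seq T) (P : pred T) F :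
  (forall i, P i -> ideal_pow I n (F i)) -> ideal_pow I n (\sum_(i <- r | P i) F i).
Proof. by move=> h; elim/big_ind: _ => //; [exact: ideal_pow0 | exact: ideal_powD]. Qed.

Lemma ideal_powN n x : ideal_pow I n x -> ideal_pow I n (- x).
Proof. by move=> h; rewrite -mulN1r; apply: ideal_powM. Qed.

Lemma ideal_powS n x y : I x -> ideal_pow I n y -> ideal_pow I n.+1 (x * y).
Proof.
move=> Ix Iy; exists 1%N, (fun _ => x), (fun _ => y); split=> //.
by rewrite big_ord1.
Qed.

Lemma ideal_pow_pred n x : ideal_pow I n.+1 x -> ideal_pow I n x.
Proof.
move=> [m [a [b [ab ->]]]]; apply: ideal_pow_sum => i _.
by apply: ideal_powM; case: (ab i).
Qed.

Definition invertible (x : k) := exists y, y * x = 1.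

Lemma invertible1 : invertible 1. Proof. by exists 1; rewrite mulr1. Qed.

Lemma invertibleM x y : invertible x -> invertible y -> invertible (x * y).
Proof. by case=> a ax [b by_]; exists (a * b); rewrite mulrACA ax by_ mulr1. Qed.

Lemma invertible_prod (T : eqType) (r : seq T) (F : T -> k) :
  (forall i, i \in r -> invertible (F i)) -> invertible (\prod_(i <- r) F i).
Proof.
move=> h; rewrite big_seq; elim/big_ind: _ => //; [exact: invertible1 | exact: invertibleM].
Qed.

Lemma invertibleX x n : invertible x -> invertible (x ^+ n).
Proof.
move=> h; elim: n => [|n IHn]; first by rewrite expr0; exact: invertible1.
by rewrite exprS; apply: invertibleM.
Qed.

Lemma invertible_cancel (V : lmodType k) x (v : V) : invertible x -> x *: v = 0 -> v = 0.
Proof. by case=> y yx xv; rewrite -[v]scale1r -yx -scalerA xv scaler0. Qed.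

Lemma ideal_prod_pow (T : eqType) (r s : seq T) (F : T -> k) :
  uniq s -> {subset s <= r} -> (forall i, i \in s -> I (F i)) ->
  ideal_pow I (size s) (\prod_(i <- r) F i).
Proof.
elim: s r => [//|i s IHs] r /= /andP[is_ us] sr IF.
rewrite (perm_big _ (perm_to_rem (sr i (mem_head _ _)))) big_cons.
apply: ideal_powS; first by apply: IF; rewrite mem_head.
apply: IHs => // [j js|j js]; last by apply: IF; rewrite inE js orbT.
have jr : j \in r by apply: sr; rewrite inE js orbT.
by have := perm_mem (perm_to_rem (sr i (mem_head _ _))) j; rewrite jr inE;
  case: eqP js is_ => [-> ->//|_ _ _ /esym].
Qed.

Hypothesis complI : adically_complete I.

(* The geometric series converges, so [I] lies in the Jacobson radical. *)
Lemma invertible_sub_ideal x : I x -> invertible (1 - x).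
Proof.
move=> Ix; have xn n : ideal_pow I n (x ^+ n).
  by elim: n => [//|n IHn]; rewrite exprS; apply: ideal_powS.
case: complI => sep /(_ (fun n => \sum_(i < n) x ^+ i)) []; first by
  move=> n; rewrite big_ord_recr /= addrAC subrr add0r.
move=> L hL; exists L; apply/eqP; rewrite -subr_eq0; apply/eqP/sep => n.
have -> : L * (1 - x) - 1 = (1 - x) * (L - \sum_(i < n) x ^+ i) - x ^+ n.
  have e : (1 - x) * (\sum_(i < n) x ^+ i) = 1 - x ^+ n.
    by rewrite -opprB mulNr -subrX1 opprB.
  by rewrite [(1 - x) * (_ - _)]mulrBr e opprB addrA addrAC addrK mulrC.
by apply: ideal_powD; [exact: ideal_powM | exact: ideal_powN].
Qed.
End Ideals.

(* Division by a variable makes [lia] diverge, so quotients and remainders are abstracted first. *)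
Ltac nodiv_lia := repeat match goal with
  | |- context [divn ?a ?b] => let q := fresh in set q := divn a b; clearbody q
  | |- context [modn ?a ?b] => let q := fresh in set q := modn a b; clearbody q
  end; lia.

(** * Structure constants and carries *)

Section Coefficients.
Variables (k : comPzRingType) (pi : nat -> k).

Lemma epsC j a b : eps j a b = eps j b a.
Proof. by rewrite /eps addnC -!subnDA [(_ %/ j + _)%N]addnC. Qed.

(** Superadditivity of the floor makes the truncated subtractions in [eps] exact. *)
Lemma leq_floorD j a b : (a %/ j + b %/ j <= (a + b) %/ j)%N.
Proof.
case: j => [|j]; first by rewrite !divn0.
rewrite [leqRHS](_ : _ = ((a %/ j.+1 + b %/ j.+1) * j.+1 + (a %% j.+1 + b %% j.+1)) %/ j.+1)%N.
  by rewrite divnMDl // leq_addr.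
by congr (_ %/ _)%N; have := divn_eq a j.+1; have := divn_eq b j.+1; nodiv_lia.
Qed.

(** Both sides equal floor((a+b+c)/j) minus the three separate floors; associativity of D comes from
    this. *)
Lemma eps_assoc j a b c : (eps j (a + b) c + eps j a b = eps j a (b + c) + eps j b c)%N.
Proof.
rewrite /eps addnA.
have := leq_floorD j (a + b) c; have := leq_floorD j a b.
have := leq_floorD j a (b + c); have := leq_floorD j b c; rewrite addnA.
nodiv_lia.
Qed.

Lemma eps_big j a b : (a + b < j)%N -> eps j a b = 0%N.
Proof. by move=> h; rewrite /eps !divn_small //; lia. Qed.

Lemma eps_mod j a b : (0 < j)%N -> (a %% j + b %% j < j)%N -> eps j a b = 0%N.
Proof.
move=> j0 h; rewrite /eps.
have -> : (a + b = (a %/ j + b %/ j) * j + (a %% j + b %% j))%N.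
  by have := divn_eq a j; have := divn_eq b j; nodiv_lia.
by rewrite divnMDl // (divn_small h); nodiv_lia.
Qed.

Lemma eps_dvd j a b : (j %| a)%N -> eps j a b = 0%N.
Proof.
case: j => [|j] h; first by rewrite /eps !divn0.
by apply: eps_mod => //; rewrite (eqP h) add0n ltn_mod.
Qed.

(* [cc a b] is the structure constant of x^[a] x^[b]. *)
Definition cc (a b : nat) : k := Ccoef pi (a + b) b.

(** Factors with j > a + b are 1, so several structure constants can be written over one range and
    compared factor by factor. *)
Lemma ccE m a b : (a + b < m)%N -> cc a b = \prod_(2 <= j < m) pi j ^+ eps j a b.
Proof.
move=> abm; rewrite /cc /Ccoef addnK.
case: (leqP 2 (a + b).+1) => h.
  rewrite (@big_cat_nat _ _ _ (a + b).+1 2 m) //=.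
  rewrite [X in _ * X]big_nat_cond [X in _ * X]big1 ?mulr1 //.
  by move=> j /andP[/andP[j1 _] _]; rewrite eps_big ?expr0.
rewrite big_geq; last by lia.
rewrite big_nat_cond big1 // => j /andP[/andP[j1 _] _].
by rewrite eps_big ?expr0 //; lia.
Qed.

Lemma ccC a b : cc a b = cc b a.
Proof.
rewrite (@ccE (a + b).+1) // (@ccE (a + b).+1 b a); last by lia.
by apply: eq_bigr => j _; rewrite epsC.
Qed.

Lemma cc0 a : cc a 0 = 1.
Proof.
by rewrite (@ccE (a + 0).+1) // big1 // => j _; rewrite epsC eps_dvd ?expr0 ?dvdn0.
Qed.

Lemma cc_assoc a b c : cc (a + b) c * cc a b = cc a (b + c) * cc b c.
Proof.
rewrite !(@ccE (a + b + c).+1); try lia.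
by rewrite -!big_split /=; apply: eq_bigr => j _; rewrite -!exprD eps_assoc.
Qed.

Lemma xcoefE (d e f : int) : d <= e -> e <= f -> xcoef pi d e f = cc `|f - e|%N `|e - d|%N.
Proof.
move=> de ef; rewrite /xcoef /cc; congr (Ccoef _ _ _); lia.
Qed.

Lemma cc_invertible a b :
  (forall j, (1 < j)%N -> eps j a b != 0%N -> invertible (pi j)) -> invertible (cc a b).
Proof.
move=> h; apply: invertible_prod => j; rewrite mem_index_iota => /andP[j1 _].
rewrite addnK; have [->|/(h _ j1)] := eqVneq (eps j a b) 0%N.
  by rewrite expr0; exact: invertible1.
exact: invertibleX.
Qed.

Variable I : k -> Prop.
Hypothesis idI : is_ideal I.

Lemma cc_ideal_pow (s : seq nat) a b : uniq s ->
  (forall j, j \in s -> [/\ (1 < j)%N, I (pi j) & eps j a b != 0%N]) ->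
  ideal_pow I (size s) (cc a b).
Proof.
move=> us h; apply: ideal_prod_pow => // j js; have [j1 Ij ej] := h j js.
  rewrite mem_index_iota j1 ltnNge /=; apply: contraNN ej => abj.
  by apply/eqP/eps_big.
rewrite addnK; case: (eps j a b) ej => // e _; rewrite exprS mulrC.
by case: idI => _ _; apply.
Qed.

(* Adding [b] to [a] crosses a multiple of [n]; each [j] in [s] is a divisor of [n] exceeding [b], so it carries as well. *)
Lemma cc_crossing (s : seq nat) n a b : uniq s ->
  (forall j, j \in s -> [/\ (1 < j)%N, I (pi j), (j %| n)%N & (b < j)%N]) ->
  (a %/ n != (a + b) %/ n)%N -> ideal_pow I (size s) (cc a b).
Proof.
move=> us h cross; apply: cc_ideal_pow => // j js; have [j1 Ij jn bj] := h j js.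
split=> //; rewrite /eps (divn_small bj) subn0 subn_eq0 -ltnNge.
have n0 : (0 < n)%N by case: (n) cross => //; rewrite !divn0.
have lt : (a %/ n < (a + b) %/ n)%N by rewrite ltn_neqAle cross leq_div2r // leq_addr.
rewrite leq_divRL ?(ltnW j1)//; have A := leq_divM (a + b) n.
have B : (a < (a %/ n).+1 * n)%N by exact: ltn_ceil.
move: jn => /dvdnP[t nE]; subst n.
have C : (a %/ j < (a %/ (t * j)).+1 * t)%N by rewrite ltn_divLR ?(ltnW j1) // -mulnA.
apply: leq_trans A; rewrite mulnA leq_mul2r; apply/orP; right.
by apply: leq_trans C _; rewrite leq_mul2r lt orbT.
Qed.
End Coefficients.

(** * Bar cochains *)

Arguments gact {k pi} g d e _.
Arguments ghom {k pi} A B.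
Arguments ghfun {k pi A B} g d _.
Arguments GMod {k pi} gcomp gact _ _ _ _.
Arguments GHom {k pi A B} ghfun _ _.

HB.instance Definition _ (k : comPzRingType) (pi : nat -> k) (X : gmod k pi) d e :=
  GRing.isLinear.Build k (X d) (X e) *:%R (gact X d e) (gact_add k pi X d e).
HB.instance Definition _ (k : comPzRingType) (pi : nat -> k) (A B : gmod k pi)
    (f : ghom A B) d :=
  GRing.isLinear.Build k (A d) (B d) *:%R (ghfun f d) (ghlin k pi A B f d).

Section Cochains.
Variables (k : comPzRingType) (pi : nat -> k).
Implicit Types X Y : gmod k pi.
Local Notation cc := (cc pi).

Lemma gact_cc X d e f (v : X d) : d <= e -> e <= f ->
  gact X e f (gact X d e v) = cc `|f - e|%N `|e - d|%N *: gact X d f v.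
Proof. by move=> de ef; rewrite gact_comp // xcoefE. Qed.

Lemma gact_ccn X d e f (a b : nat) (v : X d) : e = d + a%:Z -> f = e + b%:Z ->
  gact X e f (gact X d e v) = cc b a *: gact X d f v.
Proof.
move=> ed fe; rewrite gact_cc; try lia.
have -> : absz (f - e) = b by lia.
by have -> : absz (e - d) = a by lia.
Qed.

Lemma gact_index X d d' e (F : forall d, X d) : d = d' -> gact X d e (F d) = gact X d' e (F d').
Proof. by move->. Qed.

Lemma gact_self X d e (F : forall d, X d) : d = e -> gact X d e (F d) = F e.
Proof. by move->; rewrite gact_id. Qed.

Section Bar.
Variable N : nat.

(* [bar g q0 q] is the inner part of the bar differential, with the bracket
   [q0 | q1 | ...] standing for x^[(q0+1)N] | x^[(q1+1)N] | ... *)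
Fixpoint bar (V : lmodType k) (g : seq nat -> V) (q0 : nat) (q : seq nat) : V :=
  if q is q1 :: q' then
    cc (q0.+1 * N) (q1.+1 * N) *: g ((q0 + q1).+1 :: q') - bar (fun s => g (q0 :: s)) q1 q'
  else 0.

(** Each entry q stands for x^[(q+1)N], so the bracket has degree [total s * N]. *)
Definition total (s : seq nat) := (sumn s + size s)%N.

Lemma bar_ext_total (V : lmodType k) (g g' : seq nat -> V) q0 q :
  (forall s, size s = size q -> total s = total (q0 :: q) -> g s = g' s) ->
  bar g q0 q = bar g' q0 q.
Proof.
elim: q g g' q0 => [//|q1 q IHq] g g' q0 gg' /=; rewrite gg' //; last first.
  by rewrite /total /=; lia.
congr (_ - _); apply: IHq => s ss ts; apply: gg'; first by rewrite /= ss.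
by move: ts; rewrite /total /=; lia.
Qed.

Lemma bar_ext p (V : lmodType k) (g g' : seq nat -> V) q0 q :
  (forall s, size s = p -> g s = g' s) -> size q = p -> bar g q0 q = bar g' q0 q.
Proof. by move=> gg' sq; apply: bar_ext_total => s ss _; apply: gg'; rewrite ss. Qed.

Lemma bar0 (V : lmodType k) q0 q : bar (fun _ => 0 : V) q0 q = 0.
Proof. by elim: q q0 => [//|q1 q IHq] q0 /=; rewrite IHq scaler0 subr0. Qed.

Lemma barB (V : lmodType k) a (g g' : seq nat -> V) q0 q :
  bar (fun s => a *: g s - g' s) q0 q = a *: bar g q0 q - bar g' q0 q.
Proof.
elim: q g g' q0 => [|q1 q IHq] g g' q0 /=; first by rewrite scaler0 subr0.
by rewrite IHq !scalerBr !scalerA [_ * a]mulrC !opprD !opprK addrACA.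
Qed.

Lemma bar_map (V W : lmodType k) (phi : {linear V -> W}) (g : seq nat -> V) q0 q :
  phi (bar g q0 q) = bar (fun s => phi (g s)) q0 q.
Proof.
elim: q g q0 => [|q1 q IHq] g q0 /=; first by rewrite raddf0.
rewrite linearB. rewrite linearZ_LR. by rewrite IHq.
Qed.

(** Applied twice, the inner differential leaves only the merge of the first two entries; in
    [delta_delta] this cancels against the inner part of [delta f] at the merged bracket. *)
Lemma bar_bar (V : lmodType k) (g : seq nat -> V) q0 q1 q :
  bar (bar g q0) q1 q = cc (q0.+1 * N) (q1.+1 * N) *: bar g (q0 + q1).+1 q.
Proof.
elim: q g q0 q1 => [|q2 q IHq] g q0 q1 /=; first by rewrite scaler0.
have -> : bar (fun s => bar g q0 (q1 :: s)) q2 q =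
    cc (q0.+1 * N) (q1.+1 * N) *: bar (fun s => g ((q0 + q1).+1 :: s)) q2 q
    - bar (bar (fun s => g (q0 :: s)) q1) q2 q.
  by rewrite -barB.
rewrite IHq !scalerBr !scalerA opprB.
rewrite addrA addrNK; congr (_ - _).
have -> : ((q0 + (q1 + q2).+1).+1 = ((q0 + q1).+1 + q2).+1)%N by lia.
congr (_ *: _); rewrite mulrC [RHS]mulrC.
have := cc_assoc pi (q0.+1 * N) (q1.+1 * N) (q2.+1 * N).
have -> : (q1.+1 * N + q2.+1 * N = (q1 + q2).+2 * N)%N by lia.
by have -> : (q0.+1 * N + q1.+1 * N = (q0 + q1).+2 * N)%N by lia.
Qed.

(** All lengths and degrees at once: e is the target degree, and e - [total s * N] the source
    degree. Statements restrict to brackets of one size. *)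
Definition cochain X := forall e : int, seq nat -> X e.

(** The normalised bar differential for Ext_E(k, X), with E spanned by the x^[qN]: the term in which
    the last entry acts on k is absent because entries have positive degree. The value 0 on the
    empty bracket is a convention. *)
Definition delta X (f : cochain X) : cochain X := fun e s =>
  if s is q0 :: q then
    gact X (e - (q0.+1 * N)%N%:Z) e (f (e - (q0.+1 * N)%N%:Z) q) - bar (f e) q0 q
  else 0.

(** The source degree is preserved and the total does not grow; this locality makes filtrations by
    degree compatible with [delta]. *)
Lemma delta_ext_total X (f g : cochain X) e s :
  (forall e' s', (size s').+1 = size s -> (total s' <= total s)%N ->
    e' - (total s' * N)%N%:Z = e - (total s * N)%N%:Z -> f e' s' = g e' s') ->
  delta f e s = delta g e s.
Proof.
case: s => [//|q0 q] fg /=; rewrite fg //; last 2 first.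
- by rewrite /total /=; lia.
- rewrite -addrA -opprD -PoszD -mulnDl; congr (_ - (_ * _)%N%:Z).
  by rewrite /total /=; lia.
congr (_ - _); apply: bar_ext_total => s ss ts.
by apply: fg; rewrite /= ?ss ?ts.
Qed.

Lemma delta_ext p X (f g : cochain X) :
  (forall e s, size s = p -> f e s = g e s) ->
  forall e s, size s = p.+1 -> delta f e s = delta g e s.
Proof.
move=> fg e s ss; apply: delta_ext_total => e' s' ss' _ _; apply: fg.
by move: ss'; rewrite ss => -[].
Qed.

Lemma delta0 X e s : delta (fun e _ => 0 : X e) e s = 0.
Proof. by case: s => [//|q0 q] /=; rewrite linear0 bar0 subr0. Qed.

Lemma deltaB X (f g : cochain X) e s :
  delta (fun e s => f e s - g e s) e s = delta f e s - delta g e s.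
Proof.
case: s => [|q0 q] /=; first by rewrite subr0.
rewrite linearB.
have -> : bar (fun s => f e s - g e s) q0 q = bar (f e) q0 q - bar (g e) q0 q.
  rewrite -[bar (f e) q0 q]scale1r -barB.
  by apply: bar_ext (erefl _) => s _; rewrite scale1r.
by rewrite !opprB addrACA [RHS]addrACA; congr (_ + _); exact: addrC.
Qed.

Lemma delta_ghom X Y (phi : ghom X Y) (f : cochain X) e s :
  ghfun phi e (delta f e s) = delta (fun e s => ghfun phi e (f e s)) e s.
Proof.
case: s => [|q0 q] /=; first by rewrite linear0.
by rewrite linearB /= ghcomm bar_map.
Qed.

Lemma delta_delta X (f : cochain X) e s : delta (delta f) e s = 0.
Proof.
case: s => [//|q0 [|q1 q]] /=; first by rewrite linear0 subr0.
have -> : bar (fun s => delta f e (q0 :: s)) q1 q =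
    bar (fun s => gact X (e - (q0.+1 * N)%N%:Z) e (f (e - (q0.+1 * N)%N%:Z) s)) q1 q
    - bar (bar (f e) q0) q1 q.
  rewrite -[X in X - _]scale1r -barB.
  by apply: bar_ext (erefl _) => s _; rewrite scale1r.
rewrite bar_bar linearB /= (gact_ccn (a := q1.+1 * N) (b := q0.+1 * N)); try lia.
rewrite bar_map /= scalerBr.
rewrite (@gact_index X _ (e - ((q0 + q1).+2 * N)%N%:Z) e (fun d => f d q)); last by lia.
by rewrite opprB addrA addrA addrNK subrr.
Qed.

Section Homotopy.
Variables (X : gmod k pi) (P Q : pred nat).

(** An element of Hom(E, X) in degree e takes the value [c (e + pN) p] at x^[pN]; letting the degree
    vary freely keeps e out of the type. *)
Definition family := forall e : int, nat -> X e.

(* [sigma] plays the role of a retraction of X -> Hom(E, X), where E is spanned by the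
   x^[pN]: only the coefficients at [p] in [P] matter, and it commutes with x^[qN] for
   [q] in [Q]. *)
Variable sigma : forall e : int, family -> X e.
Hypothesis sigma_lin : forall e a (c c' : family),
  sigma e (fun d p => a *: c d p - c' d p) = a *: sigma e c - sigma e c'.
Hypothesis sigma_loc : forall e (c c' : family),
  (forall p, P p -> c (e + (p * N)%N%:Z) p = c' (e + (p * N)%N%:Z) p) ->
  sigma e c = sigma e c'.
Hypothesis sigma_eta : forall e (m : forall e, X e),
  sigma e (fun d p => gact X (d - (p * N)%N%:Z) d (m (d - (p * N)%N%:Z))) = m e.
Hypothesis sigma_equiv : forall e q (c : family), Q q ->
  gact X (e - (q * N)%N%:Z) e (sigma (e - (q * N)%N%:Z) c) =
  sigma e (fun d p => cc (p * N) (q * N) *: c d (p + q)%N).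

(** The value at x^[0] is 0, as in the normalised complex; the offset is there because an entry p'
    stands for x^[(p'+1)N]. *)
Definition shift_family (f : cochain X) s : family :=
  fun d p => if p is p'.+1 then f d (p' :: s) else 0.

Definition contraction (f : cochain X) : cochain X :=
  fun e s => sigma e (shift_family f s).

Lemma sigma_bar e (G : seq nat -> family) q0 q :
  bar (fun s => sigma e (G s)) q0 q = sigma e (fun d p => bar (fun s => G s d p) q0 q).
Proof.
elim: q G q0 => [|q1 q IHq] G q0 /=.
  have := sigma_lin e 1 (fun _ _ => 0) (fun _ _ => 0); rewrite scale1r subrr => <-.
  by apply: sigma_loc => p _; rewrite scaler0 subr0.
by rewrite sigma_lin IHq.
Qed.

(** Apply [sigma] to the cocycle identities on the brackets [p, q1 | q]: [sigma_eta] returns the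
    value of f, and [sigma_equiv] turns the merged terms into the outer action. Only the identities
    with p + 1 in [P] are read, so truncated retractions can be used. *)
Lemma contractionP (f : cochain X) e q1 q :
  Q q1.+1 ->
  (forall p, P p.+1 -> delta f (e + (p.+1 * N)%N%:Z) [:: p, q1 & q] = 0) ->
  f e (q1 :: q) = delta (contraction f) e (q1 :: q).
Proof.
move=> Qq fcocycle; rewrite /= sigma_equiv // -{1}(sigma_eta e (fun d => f d (q1 :: q))).
rewrite sigma_bar -[X in _ = X - _]scale1r -sigma_lin.
(* At p = 0 both sides are f itself, since the normalised families vanish at x^[0]. *)
apply: sigma_loc => -[|p] Pp /=.
  rewrite scale1r mul0n ccC cc0 scale1r.
  rewrite (@gact_self X _ _ (fun d => f d (q1 :: q))); last by rewrite subr0.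
  by rewrite bar0 [RHS]subr0.
have /eqP := fcocycle p Pp; rewrite /= subr_eq0 => /eqP ->.
by rewrite scale1r addnS.
Qed.
End Homotopy.
End Bar.
End Cochains.

(** * Coinduced modules *)

Section DependentProduct.
Variables (k : comPzRingType) (T : Type) (V : T -> lmodType k).

Definition dprod := forall t, V t.

Lemma dprodP (x y : dprod) : (forall t, x t = y t) -> x = y.
Proof. exact: functional_extensionality_dep. Qed.

HB.instance Definition _ := gen_eqMixin dprod.
HB.instance Definition _ := gen_choiceMixin dprod.

Let zero : dprod := fun _ => 0.
Let add (x y : dprod) : dprod := fun t => x t + y t.
Let opp (x : dprod) : dprod := fun t => - x t.
Let scale a (x : dprod) : dprod := fun t => a *: x t.

Fact dprod_addA : associative add.
Proof. by move=> x y z; apply: dprodP => t; exact: addrA. Qed.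
Fact dprod_addC : commutative add.
Proof. by move=> x y; apply: dprodP => t; exact: addrC. Qed.
Fact dprod_add0 : left_id zero add.
Proof. by move=> x; apply: dprodP => t; exact: add0r. Qed.
Fact dprod_addN : left_inverse zero opp add.
Proof. by move=> x; apply: dprodP => t; exact: addNr. Qed.
HB.instance Definition _ :=
  GRing.isZmodule.Build dprod dprod_addA dprod_addC dprod_add0 dprod_addN.

Fact dprod_scaleA a b x : scale a (scale b x) = scale (a * b) x.
Proof. by apply: dprodP => t; exact: scalerA. Qed.
Fact dprod_scale1 : left_id 1 scale.
Proof. by move=> x; apply: dprodP => t; exact: scale1r. Qed.
Fact dprod_scaleDr : right_distributive scale +%R.
Proof. by move=> a x y; apply: dprodP => t; exact: scalerDr. Qed.
Fact dprod_scaleDl x : {morph scale^~ x : a b / a + b}.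
Proof. by move=> a b; apply: dprodP => t; exact: scalerDl. Qed.
HB.instance Definition _ := GRing.Zmodule_isLmodule.Build k dprod
  dprod_scaleA dprod_scale1 dprod_scaleDr dprod_scaleDl.

Lemma dprodDE (x y : dprod) t : (x + y) t = x t + y t. Proof. by []. Qed.
Lemma dprodZE a (x : dprod) t : (a *: x) t = a *: x t. Proof. by []. Qed.
End DependentProduct.

Section Coinduced.
Variables (k : comPzRingType) (pi : nat -> k).
Implicit Types X Y : gmod k pi.
Local Notation cc := (cc pi).

Definition upset (d : int) := {e : int | d <= e}.

Section Coind.
Variable X : gmod k pi.

(** Degree d of the graded Hom_k(D, X): a form sends x^[e-d] into X e, independently for each e >=
    d. *)
Definition coind_comp (d : int) : lmodType k := dprod (fun s : upset d => X (val s)).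

(** Precomposition with multiplication by x^[a-d] on D. *)
Definition coind_act (d a : int) (c : coind_comp d) : coind_comp a := fun s =>
  match @idP (d <= a) with
  | ReflectT da => xcoef pi d a (val s) *: c (exist _ (val s) (le_trans da (valP s)))
  | ReflectF _ => 0
  end.

Arguments coind_act {d} a c.

(* A family of elements, viewed as the element x^[e-d] |-> F e of Hom_k(D, X) in degree d. *)
Definition cosection (F : forall e, X e) d : coind_comp d := fun s => F (val s).
Arguments cosection F d : clear implicits.

Lemma coind_act_section F d a : d <= a ->
  coind_act a (cosection F d) = cosection (fun e => xcoef pi d a e *: F e) a.
Proof. by move=> da; apply: dprodP => s; rewrite /coind_act; case: {-}_ / idP. Qed.

(** Extending by zero below d lets later arguments work with plain families instead of subtypes. *)
Lemma coind_section d (c : coind_comp d) : exists F, c = cosection F d.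
Proof.
exists (fun e => match @idP (d <= e) return X e with
  | ReflectT de => c (exist _ e de : upset d) | ReflectF _ => 0 end).
apply: dprodP => -[e de]; rewrite /cosection /=.
by case: {-}_ / idP => // de'; rewrite (bool_irrelevance de' de).
Qed.

Fact coind_act_add d a x (u v : coind_comp d) :
  coind_act a (x *: u + v) = x *: coind_act a u + coind_act a v.
Proof.
apply: dprodP => s; rewrite dprodDE dprodZE /coind_act; case: {-}_ / idP => [da|_].
  by rewrite dprodDE dprodZE scalerDr !scalerA mulrC.
by rewrite scaler0 addr0.
Qed.

Fact coind_act_neg d a (v : coind_comp d) : a < d -> coind_act a v = 0.
Proof.
move=> ad; apply: dprodP => s; rewrite /coind_act; case: {-}_ / idP => // da.
by have := le_lt_trans da ad; rewrite ltxx.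
Qed.

Fact coind_act_id d (v : coind_comp d) : coind_act d v = v.
Proof.
have [F ->] := coind_section v; rewrite coind_act_section //.
apply: dprodP => -[e de]; rewrite /cosection /= xcoefE //.
by rewrite subrr absz0 cc0 scale1r.
Qed.

Fact coind_act_comp d e f (v : coind_comp d) : d <= e -> e <= f ->
  coind_act f (coind_act e v) = xcoef pi d e f *: coind_act f v.
Proof.
move=> de ef; have [F ->] := coind_section v.
rewrite !coind_act_section //; last exact: le_trans ef.
apply: dprodP => -[g fg]; rewrite /cosection dprodZE /= !scalerA; congr (_ *: _).
rewrite !xcoefE //; try lia.
have := cc_assoc pi (absz (g - f)) (absz (f - e)) (absz (e - d)).
have -> : (absz (g - f) + absz (f - e))%N = absz (g - e) by lia.
have -> : (absz (f - e) + absz (e - d))%N = absz (f - d) by lia.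
by rewrite mulrC => ->; rewrite mulrC.
Qed.

Definition coind : gmod k pi := GMod coind_comp (fun d a => coind_act a)
  coind_act_add coind_act_neg coind_act_id coind_act_comp.

Lemma gact_coind d a (F : forall e, X e) : d <= a ->
  gact coind d a (cosection F d) = cosection (fun e => xcoef pi d a e *: F e) a.
Proof. exact: coind_act_section. Qed.

Lemma cosection_ext d (F G : forall e, X e) : (forall e, d <= e -> F e = G e) ->
  cosection F d = cosection G d.
Proof. by move=> FG; apply: dprodP => -[e de]; exact: FG. Qed.

Fact coind_unit_lin d a (u v : X d) :
  (cosection (fun e => gact X d e (a *: u + v)) d : coind d) =
  a *: cosection (fun e => gact X d e u) d + cosection (fun e => gact X d e v) d.
Proof. by apply: dprodP => s; rewrite /cosection gact_add. Qed.

Fact coind_unit_comm d a (v : X d) :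
  (cosection (fun e => gact X a e (gact X d a v)) a : coind a) =
  gact coind d a (cosection (fun e => gact X d e v) d).
Proof.
have [da|ad] := lerP d a.
  rewrite gact_coind //; apply: cosection_ext => e ae.
  by rewrite gact_comp.
rewrite [RHS]gact_neg //; apply: dprodP => s.
by rewrite /cosection [gact X d a v]gact_neg // linear0.
Qed.

Definition coind_unit : ghom X coind := GHom (A := X) (B := coind)
  (fun d v => cosection (fun e => gact X d e v) d) coind_unit_lin coind_unit_comm.

Lemma coind_unit_inj d : injective (ghfun coind_unit d).
Proof.
move=> u v /(congr1 (fun c : dprod _ => c (exist _ d (lexx d)))).
by rewrite /= /cosection /= !gact_id.
Qed.
End Coind.
Arguments cosection {X} F d.

(* Injectivity relative to the k-split monomorphisms. *)
Definition rel_injective X := exists rho : ghom (coind X) X,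
  forall d v, ghfun rho d (ghfun (coind_unit X) d v) = v.

Lemma injective_rel_injective X : ginjective X -> rel_injective X.
Proof.
move=> inj; have [|rho hrho] := inj X (coind X) (coind_unit X)
   (GHom (A := X) (B := X) (fun d v => v) (fun _ _ _ _ => erefl) (fun _ _ _ => erefl)).
  exact: coind_unit_inj.
by exists rho.
Qed.

(** Evaluates the inner form at x^[0]. *)
Definition coind_ret_fun X d (c : coind (coind X) d) : coind X d :=
  fun s => c s (exist _ (val s) (lexx (val s))).

Lemma coind_rel_injective X : rel_injective (coind X).
Proof.
unshelve eexists (GHom (A := coind (coind X)) (B := coind X) (@coind_ret_fun X) _ _).
- by [].
- move=> d a c; apply: dprodP => s; rewrite /= /coind_ret_fun /coind_act.
  by case: {-}_ / idP.
move=> d v; have [F ->] := coind_section v.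
apply: dprodP => -[e de] /=; rewrite /coind_ret_fun /cosection /= coind_act_section //.
by rewrite /cosection /= xcoefE // subrr absz0 ccC cc0 scale1r.
Qed.

End Coinduced.
Arguments cosection {k pi X} F d : rename.

(** * Retractions of relatively injective modules *)

Section Reciprocal.
Variable k : comPzRingType.

(* Junk value 0 off the invertible elements. *)
Definition recip (x : k) : k :=
  if pselect (exists y, y * x = 1) is left h then projT1 (cid h) else 0.

Lemma recipK x : invertible x -> recip x * x = 1.
Proof. by rewrite /recip; case: pselect => // h _; case: (cid h). Qed.

Lemma recip_swap x y z w : invertible y -> invertible z ->
  x * y = z * w -> x * recip z = recip y * w.
Proof.
move=> /recipK y1 /recipK z1 xy.
have -> : x * recip z = recip y * y * (x * recip z) by rewrite y1 mul1r.
have -> : recip y * y * (x * recip z) = recip y * recip z * (x * y) by ring.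
have -> : recip y * recip z * (x * y) = recip z * z * (recip y * w) by rewrite xy; ring.
by rewrite z1 mul1r.
Qed.
End Reciprocal.

Section RelativelyInjective.
Variables (k : comPzRingType) (pi : nat -> k).
Implicit Types X Y : gmod k pi.
Local Notation cc := (cc pi).

Definition good N := (0 < N)%N /\
  forall j, (1 < j)%N -> [\/ invertible (pi j), (j %| N)%N | (N %| j)%N].

Lemma good1 : good 1.
Proof. by split=> // j _; constructor 3; rewrite dvd1n. Qed.

(** Only j dividing N or divisible by N matter. The former divide qN; for the latter the residue of
    qN modulo j is at most j - N, so adding b < N does not carry. *)
Lemma good_cc_invertible N q b : good N -> (b < N)%N -> invertible (cc (q * N) b).
Proof.
move=> [N0 gN] bN; apply: cc_invertible => j j1 ej.
case: (gN j j1) => // [jN|Nj].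
  by move: ej; rewrite eps_dvd ?dvdn_mull.
have [t jE] := dvdnP Nj; case/negP: ej; apply/eqP/eps_mod; first by lia.
have j0 : (0 < j)%N by lia.
rewrite jE -muln_modl (modn_small (m := b)); last first.
  by rewrite -jE; apply: leq_trans bN _; apply: dvdn_leq.
have t0 : (0 < t)%N by case: (t) jE => //; lia.
have := ltn_pmod q t0; set r := (q %% t)%N => rt.
by apply: leq_trans (_ : (r * N + N <= _)%N); rewrite ?ltn_add2l // -mulSnr leq_mul2r rt orbT.
Qed.

Section Retraction.
Variables (N : nat) (X : gmod k pi) (rho : ghom (coind X) X).
Hypothesis goodN : good N.
Hypothesis rhoK : forall d v, ghfun rho d (ghfun (coind_unit X) d v) = v.

Let coef p b := recip (cc (p * N) b).

(* D is free over the span of the x^[pN], on the x^[b] with b < N; a linear form on that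
   span extends to D accordingly. *)
Definition extend_family (c : family X) (e d : int) : X d :=
  let t := absz (d - e) in
  coef (t %/ N) (t %% N) *: gact X (d - (t %% N)%N%:Z) d (c (d - (t %% N)%N%:Z) (t %/ N)%N).

Definition retraction e (c : family X) : X e :=
  ghfun rho e (cosection (extend_family c e) e).

Lemma retraction_lin e a (c c' : family X) :
  retraction e (fun d p => a *: c d p - c' d p) = a *: retraction e c - retraction e c'.
Proof.
rewrite /retraction -linearZ_LR -linearB; congr (ghfun rho e _); apply: dprodP => s.
rewrite /cosection /extend_family linearB linearZ_LR scalerBr !scalerA mulrC.
by rewrite -scalerA.
Qed.

Lemma retraction_loc e (c c' : family X) :
  (forall p, predT p -> c (e + (p * N)%N%:Z) p = c' (e + (p * N)%N%:Z) p) ->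
  retraction e c = retraction e c'.
Proof.
move=> cc'; congr (ghfun rho e _); apply: cosection_ext => d ed.
have : d = e + (absz (d - e))%:Z by lia.
rewrite /extend_family; move: (absz _) => t dE.
have -> : d - (t %% N)%N%:Z = e + (t %/ N * N)%N%:Z.
  by rewrite {1}dE {1}(divn_eq t N) PoszD addrA addrK.
by rewrite cc'.
Qed.

Lemma retraction_eta e (m : forall e, X e) :
  retraction e (fun d p => gact X (d - (p * N)%N%:Z) d (m (d - (p * N)%N%:Z))) = m e.
Proof.
rewrite -[RHS]rhoK; congr (ghfun rho e _); apply: cosection_ext => d ed.
have : d = e + (absz (d - e))%:Z by lia.
rewrite /extend_family; move: (absz _) => t; move: (divn_eq t N).
have := ltn_pmod t (proj1 goodN).
move: (t %/ N)%N (t %% N)%N => p b bN tE dE.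
rewrite (gact_ccn (a := p * N) (b := b)); try lia.
rewrite scalerA ccC recipK; last exact: good_cc_invertible.
by rewrite scale1r; apply: gact_index; lia.
Qed.

(** The extension to D respects x^[qN]: the scalars agree by associativity for x^[b], x^[pN],
    x^[qN], after dividing by units. *)
Lemma retraction_equiv e q (c : family X) : predT q ->
  gact X (e - (q * N)%N%:Z) e (retraction (e - (q * N)%N%:Z) c) =
  retraction e (fun d p => cc (p * N) (q * N) *: c d (p + q)%N).
Proof.
move=> _; rewrite /retraction -ghcomm gact_coind; last by lia.
congr (ghfun rho e _); apply: cosection_ext => d ed; rewrite xcoefE //; last by lia.
have -> : absz (e - (e - (q * N)%N%:Z))%R = (q * N)%N by lia.
rewrite /extend_family.
have -> : absz (d - (e - (q * N)%N%:Z))%R = (absz (d - e) + q * N)%N by lia.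
rewrite divnDMl; last exact: (proj1 goodN).
rewrite (addnC _ (q * N)%N) modnMDl; have := divn_eq (absz (d - e)) N.
have := ltn_pmod (absz (d - e)) (proj1 goodN).
move: (_ %/ N)%N (_ %% N)%N => p b bN tE.
rewrite [gact X _ d (_ *: _)]linearZ_LR /= !scalerA; congr (_ *: _); rewrite /coef.
apply: recip_swap; try exact: good_cc_invertible.
have := cc_assoc pi b (p * N) (q * N); rewrite [cc b (p * N)]ccC [cc b _]ccC.
by rewrite -mulnDl tE addnC.
Qed.

End Retraction.

(** For good N a retraction of X -> Hom_k(D, X) provides a [sigma] with no restriction on the
    entries, so the homotopy is global. *)
Lemma rel_injective_exact N X p (f : cochain X) : good N -> rel_injective X ->
  (forall e s, size s = p.+2 -> delta N f e s = 0) ->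
  exists g, forall e s, size s = p.+1 -> f e s = delta N g e s.
Proof.
move=> gN [rho rhoK] fcocycle.
exists (contraction (retraction N rho) f) => e [//|q1 q] [sq].
apply: (contractionP (P := predT) (Q := predT)) => //.
- exact: retraction_lin.
- exact: retraction_loc.
- exact: retraction_eta.
- exact: retraction_equiv.
by move=> p' _; apply: fcocycle; rewrite /= sq.
Qed.

(** Such a v amounts to maps from shifts of D/D_{>=j} to X, one in each degree. *)
Definition killed j X (v : forall e, X e) :=
  forall e p, (j <= p)%N -> gact X (e - p%:Z) e (v (e - p%:Z)) = 0.

(** The form on D sending x^[j] to w and every other x^[i] to 0 is killed by D_{>j}; its image under
    the retraction is c. *)
Lemma rel_injective_lift X j (w : forall e, X e) : rel_injective X -> killed 1 w ->
  exists2 c : forall e, X e, killed j.+1 c &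
    forall e, gact X (e - j%:Z) e (c (e - j%:Z)) = w e.
Proof.
move=> [rho rhoK] w1.
pose F e (d : int) : X d := if absz (d - e) == j then w d else 0.
exists (fun e => ghfun rho e (cosection (F e) e)) => [e p jp|e].
  rewrite -ghcomm gact_coind; last by lia.
  rewrite (_ : cosection _ e = 0) ?linear0 //; apply: dprodP => -[d ed].
  by rewrite /cosection /F /= ifN ?scaler0 //; lia.
rewrite -[RHS]rhoK -ghcomm gact_coind; last by lia.
(* x^[j] times this form is the unit map applied to w e: both give w e at x^[0] and vanish at
   positive degrees, where w is killed. *)
congr (ghfun rho e _); apply: cosection_ext => d ed; rewrite /F.
have [de|nde] := eqVneq d e.
  rewrite de gact_id ifT; last by lia.
  rewrite xcoefE //; last by lia.
  by rewrite subrr absz0 ccC cc0 scale1r.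
rewrite ifN ?scaler0; last by lia.
have := w1 d (absz (d - e)); have -> : d - (absz (d - e))%:Z = e by lia.
by move=> -> //; lia.
Qed.

End RelativelyInjective.

(** * Relatively injective resolutions *)

Section Resolutions.
Variables (k : comPzRingType) (pi : nat -> k).
Implicit Types X Y : gmod k pi.

(** For p = 0 the right-hand side is 0 by convention, so the condition says that a 0-cocycle
    vanishes. *)
Definition acyclic N X p := forall f : cochain X,
  (forall e s, size s = p.+1 -> delta N f e s = 0) ->
  exists g, forall e s, size s = p -> f e s = delta N g e s.

Definition acyclic_in N X (Z : forall e, X e -> Prop) p := forall f : cochain X,
  (forall e s, size s = p -> Z e (f e s)) ->
  (forall e s, size s = p.+1 -> delta N f e s = 0) ->
  exists2 g : cochain X, forall e s, (size s).+1 = p -> Z e (g e s) &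
    forall e s, size s = p -> f e s = delta N g e s.

Definition killed_multiples N X (v : forall e, X e) :=
  forall e q, gact X (e - (q.+1 * N)%N%:Z) e (v (e - (q.+1 * N)%N%:Z)) = 0.

(** For p = qN + b with b < N, x^[b] x^[qN] is a unit multiple of x^[p], so the x^[qN] with q > 0
    generate D_{>=N}. *)
Lemma killed_multiplesE N X (v : forall e, X e) : good pi N ->
  killed_multiples N v <-> killed N v.
Proof.
move=> gN; have N0 := proj1 gN; split=> vN; last first.
  by move=> e q; apply: vN; rewrite leq_pmull.
move=> e p Np; apply: invertible_cancel (good_cc_invertible (p %/ N) gN (ltn_pmod p N0)) _.
have := vN (e - (p %% N)%N%:Z) (p %/ N).-1; rewrite prednK ?divn_gt0 //.
move=> /(congr1 (gact X _ e)); rewrite linear0.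
rewrite (gact_ccn (a := p %/ N * N) (b := p %% N)); try by nodiv_lia.
rewrite ccC => <-; congr (_ *: _); apply: gact_index.
by rewrite {1}(divn_eq p N) PoszD; nodiv_lia.
Qed.

Lemma choose_family X Y (phi : ghom X Y) (P : seq nat -> Prop) (f : cochain Y) :
  (forall e s, P s -> exists u, f e s = ghfun phi e u) ->
  exists u : cochain X, forall e s, P s -> ghfun phi e (u e s) = f e s.
Proof.
move=> H; have H' e s : exists u, P s -> ghfun phi e u = f e s.
  have [Ps|nPs] := pselect (P s); last by exists 0.
  by have [u ->] := H e s Ps; exists u.
exists (fun e s => projT1 (cid (H' e s))) => e s Ps.
by case: (cid (H' e s)) => u /=; apply.
Qed.

Variables (J : nat -> gmod k pi) (dd : forall n, ghom (J n) (J n.+1)).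
Hypothesis relinj : forall n, rel_injective (J n).
Hypothesis exactJ : forall n d (v : J n.+1 d),
  ghfun (dd n.+1) d v = 0 <-> exists u, v = ghfun (dd n) d u.

Let cycle n e (v : J n e) := ghfun (dd n) e v = 0.

Lemma dd_dd n e (v : J n e) : ghfun (dd n.+1) e (ghfun (dd n) e v) = 0.
Proof. by apply/exactJ; exists v. Qed.

(** Dimension shifting along 0 -> Z_m -> J_m -> Z_(m+1) -> 0: J_m has no higher cohomology, so
    H^(p+1) of Z_(m+1) is governed by H^(p+2) of Z_m. *)
Lemma acyclic_cycles N : good pi N ->
  (forall p, acyclic_in N (@cycle 0) p) -> forall m p, acyclic_in N (@cycle m) p.+1.
Proof.
move=> gN acyc0; elim=> [//|m IHm] p v vZ vcocycle.
have [e s sp|u uv] := @choose_family _ _ (dd m) (fun s => size s = p.+1) v.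
  by apply/exactJ; exact: vZ.
have [||w wZ uw] := IHm p.+1 (delta N u).
- move=> e s ss; rewrite /cycle delta_ghom -(vcocycle e s ss).
  by apply: delta_ext ss => e' s'; exact: uv.
- by move=> e s _; exact: delta_delta.
have [|t ut] := @rel_injective_exact _ _ N (J m) p (fun e s => u e s - w e s) gN (relinj m).
  by move=> e s ss; rewrite deltaB -uw // subrr.
exists (fun e s => ghfun (dd m) e (t e s)) => e s ss; first exact: dd_dd.
by rewrite -delta_ghom -ut //= linearB /= uv // wZ ?subr0 // ss.
Qed.

(** For K = [killed j] this is exactness at m of the complex Hom(D/D_{>=j}, J), a zero kernel being
    required at 0. *)
Definition killed_exact (K : forall X, (forall e, X e) -> Prop) m : Prop :=
  match m with
  | 0 => forall v : forall e, J 0 e, (forall e, cycle (v e)) -> K _ v -> forall e, v e = 0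
  | m'.+1 => forall v : forall e, J m'.+1 e, (forall e, cycle (v e)) -> K _ v ->
      exists2 y, K _ y & forall e, ghfun (dd m') e (y e) = v e
  end.

(** Lift v to u. Since v is killed, [delta u] is a 1-cocycle with values in the cycles, hence
    [delta w] for some w in the cycles, and u - w is a killed primitive. *)
Lemma acyclic_killed_exact N : good pi N -> (forall p, acyclic_in N (@cycle 0) p) ->
  forall m, killed_exact (@killed k pi N) m.
Proof.
move=> gN acyc0 [v vZ /killed_multiplesE vN e|m v vZ /killed_multiplesE vN].
  have [||g _] := acyc0 0%N (fun e _ => v e).
  - by move=> e' s _; exact: vZ.
  - by move=> e' [//|q [|//]] _ /=; rewrite vN // subr0.
  by move=> /(_ e [::] erefl).
have [e s _|u uv] := @choose_family _ _ (dd m) (fun s => True) (fun e _ => v e).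
  by apply/exactJ; exact: vZ.
have [||w wZ uw] := acyclic_cycles gN acyc0 (p := 0) (m := m) (f := delta N (fun e _ => u e [::])).
- move=> e s ss; rewrite /cycle delta_ghom; case: s ss => [//|q [|//]] _ /=.
  by rewrite uv // vN // subr0.
- by move=> e s _; exact: delta_delta.
exists (fun e => u e [::] - w e [::]) => [|e]; last by rewrite linearB /= uv // wZ // subr0.
apply/killed_multiplesE => // e q.
have /eqP := uw e [:: q] erefl; rewrite /= !subr0 => /eqP uwE.
by rewrite linearB /= uwE subrr.
Qed.

Lemma killed_le X i j (v : forall e, X e) : (i <= j)%N -> killed i v -> killed j v.
Proof. by move=> ij vi e p jp; apply: vi; exact: leq_trans jp. Qed.

Definition family_act X j (v : forall e, X e) e : X e := gact X (e - j%:Z) e (v (e - j%:Z)).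

Lemma killed_family_act X j (v : forall e, X e) : killed j.+1 v -> killed 1 (family_act j v).
Proof.
move=> vj e p p1; rewrite /family_act (gact_ccn (a := j) (b := p)); try lia.
have -> : e - p%:Z - j%:Z = e - (p + j)%N%:Z by lia.
by rewrite vj ?scaler0 //; lia.
Qed.

Lemma killed_pred X j (v : forall e, X e) : killed j.+1 v ->
  (forall e, family_act j v e = 0) -> killed j v.
Proof.
move=> vj v0 e p; rewrite leq_eqVlt => /orP[/eqP <-|]; first exact: v0.
exact: vj.
Qed.

(** Induction on m. A primitive y killed by D_{>=N} is improved one degree at a time: if D_{>j}
    kills y, then x^[j] y is a cycle killed by positive degrees, hence [dd w] for some killed w;
    writing w = x^[j] c, the element y - [dd c] is killed by D_{>=j}. *)
Lemma killed_exact1 N : (0 < N)%N -> (forall m, killed_exact (@killed k pi N) m) ->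
  forall m, killed_exact (@killed k pi 1) m.
Proof.
move=> N0 exN; elim=> [v vZ v1 e|m IHm v vZ v1].
  by apply: (exN 0%N) => //; apply: killed_le v1.
have [y yN yv] := exN m.+1 v vZ (killed_le N0 v1).
case: N N0 yN {exN} => // N _; elim: N y yv => [|N IHN] y yv yN; first by exists y.
have act_cycle e : cycle (family_act N.+1 y e).
  by rewrite /cycle /family_act ghcomm yv v1.
(* When y lies in J 0 there is nothing to subtract: exactness at 0 makes the obstruction vanish. *)
move: IHm y yv yN act_cycle IHN; case: (m) v vZ v1 => [|m'] v vZ v1 IHm y yv yN act_cycle IHN.
  by apply: IHN yv _; apply: (killed_pred yN) => e; exact: (IHm _ act_cycle (killed_family_act yN)).
have [w w1 wE] := IHm _ act_cycle (killed_family_act yN).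
have [c cN cw] := rel_injective_lift N.+1 (relinj m') w1.
apply: (IHN (fun e => y e - ghfun (dd m') e (c e))) => [e|].
  by rewrite linearB /= yv dd_dd subr0.
apply: killed_pred => [e p jp|e].
  by rewrite linearB /= yN // -ghcomm cN // linear0 subr0.
by rewrite /family_act linearB /= -ghcomm cw wE subrr.
Qed.

(** D/D_{>=j+1} is an extension of D/D_{>=j} by a copy of k: the class of x^[j] v is removed first,
    by subtracting [dd c] as in [killed_exact1], and what is left is killed by D_{>=j}. *)
Lemma killed_exact_all j : (forall m, killed_exact (@killed k pi 1) m) ->
  forall m, killed_exact (@killed k pi j.+1) m.
Proof.
move=> ex1; elim: j => [//|j IHj] m.
have act_cycle m' (v : forall e, J m' e) e :
    (forall e, cycle (v e)) -> cycle (family_act j.+1 v e).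
  by move=> vZ; rewrite /cycle /family_act ghcomm vZ linear0.
case: m => [|m] v vZ vj.
  have w0 := ex1 0%N _ (fun e => act_cycle _ _ e vZ) (killed_family_act vj).
  exact: (IHj 0%N v vZ (killed_pred vj w0)).
have [|w w1 wE] := ex1 m.+1 _ _ (killed_family_act vj); first by move=> e; exact: act_cycle.
have [c cj cw] := rel_injective_lift j.+1 (relinj m) w1.
have [||y yj yE] := IHj m.+1 (fun e => v e - ghfun (dd m) e (c e)).
- by move=> e; rewrite /cycle linearB /= vZ dd_dd subr0.
- apply: killed_pred => [e p jp|e].
    by rewrite linearB /= vj // -ghcomm cj // linear0 subr0.
  by rewrite /family_act linearB /= -ghcomm cw wE subrr.
exists (fun e => y e + c e) => [e p jp|e]; last by rewrite linearD /= yE subrK.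
by rewrite linearD /= cj // (killed_le (leqnSn j.+1) yj) // addr0.
Qed.

(** H^1 of the m-th cycles comes from exactness at m + 1, and H^(p+2) from H^(p+1) of the next
    cycles. *)
Lemma killed_exact_acyclic N : good pi N -> (forall m, killed_exact (@killed k pi N) m) ->
  (forall p, acyclic_in N (@cycle 0) p).
Proof.
move=> gN exN p.
have base : acyclic_in N (@cycle 0) 0.
  move=> v vZ vcocycle; exists v => // e [|//] _ /=.
  apply: (exN 0%N (fun e => v e [::])); first by move=> e'; apply: vZ.
  apply/killed_multiplesE => // e' q; have := vcocycle e' [:: q] erefl.
  by rewrite /= subr0.
case: p => // p; suff: forall m, acyclic_in N (@cycle m) p.+1 by apply.
elim: p => [|p IHp] m v vZ vcocycle.
  have [u vu] := rel_injective_exact gN (relinj m) vcocycle.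
  have [|| w /killed_multiplesE wN wu] := exN m.+1 (fun e => ghfun (dd m) e (u e [::])).
  - by move=> e; exact: dd_dd.
  - apply/killed_multiplesE => // e q.
    by rewrite -ghcomm; have := vu e [:: q] erefl; rewrite /= subr0 => <-; exact: vZ.
  exists (fun e s => u e [::] - w e) => [e s _|e [//|q [|//]] ss]; first by rewrite /cycle linearB /= wu subrr.
  by rewrite vu //= linearB /= wN // !subr0.
have [u vu] := rel_injective_exact gN (relinj m) vcocycle.
have [||w wZ uw] := IHp m.+1 (fun e s => ghfun (dd m) e (u e s)).
- by move=> e s _; exact: dd_dd.
- by move=> e s ss; rewrite -delta_ghom -vu //; exact: vZ.
have [e s sp|w' w'w] := @choose_family _ _ (dd m) (fun s => size s = p) w.
  by apply/exactJ; apply: wZ; rewrite sp.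
exists (fun e s => u e s - delta N w' e s) => [e s [ss]|e s ss].
  rewrite /cycle linearB /= delta_ghom uw //; apply/eqP; rewrite subr_eq0; apply/eqP.
  by apply: delta_ext ss => e' s' ss'; rewrite w'w.
by rewrite deltaB delta_delta subr0 vu.
Qed.

End Resolutions.

(** * Graded subquotients and the cobar resolution *)

Section Subquotient.
Variables (k : comPzRingType) (V : lmodType k) (S : V -> Prop).

Definition is_submod := S 0 /\ forall a u v, S u -> S v -> S (a *: u + v).

Hypothesis hS : is_submod.

Lemma submodD u v : S u -> S v -> S (u + v).
Proof. by move=> Su Sv; rewrite -[u]scale1r; apply: (proj2 hS). Qed.

Lemma submodZ a u : S u -> S (a *: u).
Proof. by move=> Su; rewrite -[_ *: _]addr0; apply: (proj2 hS) => //; apply: (proj1 hS). Qed.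

Lemma submodN u : S u -> S (- u).
Proof. by rewrite -scaleN1r; apply: submodZ. Qed.

Lemma submodB u v : S u -> S v -> S (u - v).
Proof. by move=> Su Sv; apply: submodD => //; apply: submodN. Qed.

Lemma submod_sum (T : Type) (r : seq T) (P : pred T) F :
  (forall i, P i -> S (F i)) -> S (\sum_(i <- r | P i) F i).
Proof. by move=> h; elim/big_ind: _ => //; [exact: (proj1 hS) | exact: submodD]. Qed.

(** Choosing one representative in each coset realises the quotient as the subtype of chosen
    elements. *)
Definition coset_rep x := choose (fun y => `[< S (x - y) >]) x.

Lemma coset_repP x : S (x - coset_rep x).
Proof.
apply/asboolP; apply: (@chooseP _ (fun y => `[< S (x - y) >]) x).
by apply/asboolP; rewrite subrr; exact: (proj1 hS).
Qed.

Lemma coset_rep_eq x y : S (x - y) -> coset_rep x = coset_rep y.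
Proof.
move=> Sxy; rewrite /coset_rep.
have E : (fun z => `[< S (x - z) >]) =1 (fun z => `[< S (y - z) >]).
  move=> z; apply/asboolP/asboolP => h.
    by have -> : y - z = (x - z) - (x - y); [rewrite opprB [RHS]addrC addrA subrK | exact: submodB].
  by have -> : x - z = (x - y) + (y - z); [rewrite addrA subrK | exact: submodD].
rewrite (eq_choose E); apply: choose_id; apply/asboolP.
  by rewrite -opprB; apply: submodN.
by rewrite subrr; exact: (proj1 hS).
Qed.

Definition quot_of of is_submod := {x : V | coset_rep x == x}.
Local Notation quot := (quot_of hS).

Fact coset_rep_idem x : coset_rep (coset_rep x) == coset_rep x.
Proof.
by apply/eqP/coset_rep_eq; rewrite -opprB; apply: submodN; exact: coset_repP.
Qed.

Definition quot_pi x : quot := exist _ (coset_rep x) (coset_rep_idem x).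

Lemma quot_piP x y : quot_pi x = quot_pi y <-> S (x - y).
Proof.
split=> [/(congr1 val) /= E|/coset_rep_eq E]; last exact: val_inj.
have := submodB (coset_repP x) (coset_repP y); rewrite E.
by rewrite opprB addrA subrK.
Qed.

Lemma quot_piK (x : quot) : quot_pi (val x) = x.
Proof. by apply: val_inj; apply/eqP; exact: (valP x). Qed.

HB.instance Definition _ := Choice.on quot.

Let zero : quot := quot_pi 0.
Let add (x y : quot) : quot := quot_pi (val x + val y).
Let opp (x : quot) : quot := quot_pi (- val x).
Let scale a (x : quot) : quot := quot_pi (a *: val x).

Lemma quot_repP x : S (x - val (quot_pi x)). Proof. exact: coset_repP. Qed.

Let addE x y : add (quot_pi x) (quot_pi y) = quot_pi (x + y).
Proof.
apply/quot_piP; set v := val _; set w := val _.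
have -> : v + w - (x + y) = - ((x - v) + (y - w)).
  by rewrite [RHS]opprD !opprB addrACA -opprD.
by apply: submodN; apply: submodD; exact: quot_repP.
Qed.
Let oppE x : opp (quot_pi x) = quot_pi (- x).
Proof. by apply/quot_piP; rewrite opprK addrC; exact: quot_repP. Qed.
Let scaleE a x : scale a (quot_pi x) = quot_pi (a *: x).
Proof.
by apply/quot_piP; rewrite -scalerBr -opprB scalerN; apply: submodN; apply: submodZ; exact: quot_repP.
Qed.

Fact quot_addA : associative add.
Proof.
by move=> x y z; rewrite -(quot_piK x) -(quot_piK y) -(quot_piK z) !addE addrA.
Qed.
Fact quot_addC : commutative add.
Proof. by move=> x y; rewrite /add addrC. Qed.
Fact quot_add0 : left_id zero add.
Proof. by move=> x; rewrite -(quot_piK x) addE add0r. Qed.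
Fact quot_addN : left_inverse zero opp add.
Proof. by move=> x; rewrite -(quot_piK x) oppE addE addNr. Qed.
HB.instance Definition _ :=
  GRing.isZmodule.Build quot quot_addA quot_addC quot_add0 quot_addN.

Lemma quot_piD x y : quot_pi x + quot_pi y = quot_pi (x + y). Proof. exact: addE. Qed.

Fact quot_scaleA a b x : scale a (scale b x) = scale (a * b) x.
Proof. by rewrite -(quot_piK x) !scaleE scalerA. Qed.
Fact quot_scale1 : left_id 1 scale.
Proof. by move=> x; rewrite -(quot_piK x) scaleE scale1r. Qed.
Fact quot_scaleDr : right_distributive scale +%R.
Proof.
move=> a x y; rewrite -(quot_piK x) -(quot_piK y).
by rewrite quot_piD !scaleE quot_piD scalerDr.
Qed.
Fact quot_scaleDl x : {morph scale^~ x : a b / a + b}.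
Proof. by move=> a b; rewrite -(quot_piK x) !scaleE scalerDl quot_piD. Qed.
HB.instance Definition _ := GRing.Zmodule_isLmodule.Build k quot
  quot_scaleA quot_scale1 quot_scaleDr quot_scaleDl.

Lemma quot_pi_lin a x y : quot_pi (a *: x + y) = a *: quot_pi x + quot_pi y.
Proof. by rewrite -quot_piD -scaleE. Qed.

Lemma quot_pi_eq0 x : quot_pi x = 0 <-> S x.
Proof. by rewrite -[S x]/(S x) -{2}[x]subr0; exact: quot_piP. Qed.

Definition submod_pred of is_submod : {pred V} := fun x => `[< S x >].

Fact submod_pred_closed : submod_closed (submod_pred hS).
Proof.
split=> [|a u v]; first by apply/asboolP; exact: (proj1 hS).
by move=> /asboolP Su /asboolP Sv; apply/asboolP; apply: (proj2 hS).
Qed.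
HB.instance Definition _ := GRing.isSubmodClosed.Build k V (submod_pred hS) submod_pred_closed.

Definition submod_of (h : is_submod) := {x : V | x \in submod_pred h}.
Local Notation submod := (submod_of hS).
HB.instance Definition _ := SubChoice.on submod.
HB.instance Definition _ := [SubChoice_isSubLmodule of submod by <:].

End Subquotient.

Section GradedSubquotient.
Variables (k : comPzRingType) (pi : nat -> k).
Implicit Types X Y : gmod k pi.

Section OneModule.
Variables (X : gmod k pi) (S : forall d, X d -> Prop).
Hypothesis hS : forall d, is_submod (@S d).
Hypothesis hA : forall d e v, S v -> S (gact X d e v).

Let qact d e (c : quot_of (hS d)) : quot_of (hS e) := quot_pi (hS e) (gact X d e (val c)).

Let qactE d e v : qact e (quot_pi (hS d) v) = quot_pi (hS e) (gact X d e v).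
Proof.
apply/quot_piP; rewrite -linearB; apply: hA; rewrite -opprB.
by apply: (submodN (hS d)); exact: quot_repP.
Qed.

Fact gquot_add d e a u v : @qact d e (a *: u + v) = a *: qact e u + qact e v.
Proof.
by rewrite -(quot_piK u) -(quot_piK v) -quot_pi_lin !qactE -quot_pi_lin gact_add.
Qed.
Fact gquot_neg d e (v : quot_of (hS d)) : e < d -> qact e v = 0.
Proof. by move=> ed; apply/quot_pi_eq0; rewrite gact_neg //; exact: (proj1 (hS e)). Qed.
Fact gquot_id d (v : quot_of (hS d)) : qact d v = v.
Proof. by rewrite -(quot_piK v) qactE gact_id. Qed.
Fact gquot_comp d e f (v : quot_of (hS d)) : d <= e -> e <= f ->
  qact f (qact e v) = xcoef pi d e f *: qact f v.
Proof.
move=> de ef; rewrite -(quot_piK v) !qactE gact_comp //.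
by rewrite -[_ *: gact X d f _]addr0 quot_pi_lin [X in _ + X](proj2 (quot_pi_eq0 _ _)) ?addr0 //;
  exact: (proj1 (hS f)).
Qed.

Definition gquot : gmod k pi := GMod (fun d => quot_of (hS d)) (fun d e => @qact d e)
  gquot_add gquot_neg gquot_id gquot_comp.

Fact gproj_comm d e (v : X d) : quot_pi (hS e) (gact X d e v) = gact gquot d e (quot_pi (hS d) v).
Proof. by rewrite /= qactE. Qed.

Definition gproj : ghom X gquot := GHom (A := X) (B := gquot) (fun d => quot_pi (hS d))
  (fun d => quot_pi_lin (hS d)) gproj_comm.

Lemma gproj_eq0 d (v : X d) : ghfun gproj d v = 0 <-> S v.
Proof. exact: quot_pi_eq0. Qed.

Lemma gproj_surj d (w : gquot d) : exists v, w = ghfun gproj d v.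
Proof. by exists (val w); rewrite /= quot_piK. Qed.

Let sact d e (v : submod_of (hS d)) : submod_of (hS e) :=
  exist _ (gact X d e (val v))
    (introT (asboolP _) (hA e (elimT (asboolP _) (valP v)))).

Fact gsub_add d e a u v : @sact d e (a *: u + v) = a *: sact e u + sact e v.
Proof. by apply: val_inj; rewrite /= gact_add. Qed.
Fact gsub_neg d e (v : submod_of (hS d)) : e < d -> sact e v = 0.
Proof. by move=> ed; apply: val_inj; rewrite /= gact_neg. Qed.
Fact gsub_id d (v : submod_of (hS d)) : sact d v = v.
Proof. by apply: val_inj; rewrite /= gact_id. Qed.
Fact gsub_comp d e f (v : submod_of (hS d)) : d <= e -> e <= f ->
  sact f (sact e v) = xcoef pi d e f *: sact f v.
Proof. by move=> de ef; apply: val_inj; rewrite /= gact_comp. Qed.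

Definition gsub : gmod k pi := GMod (fun d => submod_of (hS d)) (fun d e => @sact d e)
  gsub_add gsub_neg gsub_id gsub_comp.

Definition gincl : ghom gsub X := GHom (A := gsub) (B := X) (fun d => val)
  (fun d a u v => erefl) (fun d e v => erefl).

Lemma gincl_inj d : injective (ghfun gincl d).
Proof. exact: val_inj. Qed.

Lemma gsubP d (v : gsub d) : S (ghfun gincl d v).
Proof. by apply/asboolP; exact: (valP v). Qed.

Lemma gsub_ex d (v : X d) : S v -> exists w : gsub d, ghfun gincl d w = v.
Proof. by move=> Sv; exists (exist _ v (introT (asboolP _) Sv)). Qed.
End OneModule.

Definition ghom_comp X Y Z (g : ghom Y Z) (f : ghom X Y) : ghom X Z :=
  GHom (A := X) (B := Z) (fun d v => ghfun g d (ghfun f d v))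
    (fun d a u v => etrans (congr1 (ghfun g d) (ghlin k pi _ _ f d a u v)) (ghlin k pi _ _ g d a _ _))
    (fun d e v => etrans (congr1 (ghfun g e) (ghcomm k pi _ _ f d e v)) (ghcomm k pi _ _ g d e _)).

Section Augmentation.
Variables (X : gmod k pi) (J : nat -> gmod k pi) (e0 : ghom X (J 0%N)).
Variable dd : forall n, ghom (J n) (J n.+1).
Hypothesis e0_inj : forall d, injective (ghfun e0 d).
Hypothesis exact0 : forall d v, ghfun (dd 0) d v = 0 <-> exists u, v = ghfun e0 d u.

Lemma acyclic_augmentation N p :
  acyclic N X p <-> acyclic_in N (fun d v => ghfun (dd 0) d v = 0) p.
Proof.
have pull P (f : cochain (J 0%N)) : (forall e s, P s -> ghfun (dd 0) e (f e s) = 0) ->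
    exists f' : cochain X, forall e s, P s -> ghfun e0 e (f' e s) = f e s.
  by move=> fZ; apply: choose_family => e s /fZ /exact0.
split=> acX f; last first.
  move=> fcocycle; have [e s _|e s ss|g gZ fg] := acX (fun e s => ghfun e0 e (f e s)).
  - by apply/exact0; exists (f e s).
  - by rewrite -delta_ghom fcocycle // linear0.
  have [e s|g' g'g] := pull (fun s => (size s).+1 = p) g; first exact: gZ.
  exists g' => e s ss; apply: e0_inj; rewrite fg // delta_ghom.
  case: p ss g'g {gZ fg fcocycle acX} => [|p] ss g'g; first by case: s ss.
  by apply: esym; apply: delta_ext ss => e' s' ss'; rewrite g'g // ss'.
move=> fZ fcocycle; have [f' f'f] := pull (fun s => size s = p) f fZ.
have [e s ss|g fg] := acX f'.
  apply: e0_inj; rewrite linear0 delta_ghom -(fcocycle e s ss).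
  by apply: delta_ext ss => e' s' ss'; rewrite f'f.
exists (fun e s => ghfun e0 e (g e s)) => e s ss; first by apply/exact0; exists (g e s).
by rewrite -delta_ghom -fg // f'f.
Qed.
End Augmentation.

Section Cobar.
Variable X : gmod k pi.

Definition coind_image Y d (v : coind Y d) := exists u, v = ghfun (coind_unit Y) d u.

Lemma coind_image_submod Y d : is_submod (@coind_image Y d).
Proof.
split=> [|a _ _ [u ->] [v ->]]; first by exists 0; rewrite linear0.
by exists (a *: u + v); rewrite ghlin.
Qed.

Lemma coind_image_act Y d e (v : coind Y d) : coind_image v -> coind_image (gact (coind Y) d e v).
Proof. by case=> u ->; exists (gact Y d e u); rewrite ghcomm. Qed.

(** Splicing the successive cokernels of the coinduction unit yields a relatively injective
    resolution of any X. *)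
Fixpoint cosyzygy n : gmod k pi :=
  if n is n'.+1 then gquot (@coind_image_submod (cosyzygy n')) (@coind_image_act (cosyzygy n'))
  else X.

Definition cobar n : gmod k pi := coind (cosyzygy n).

Definition cobar_d n : ghom (cobar n) (cobar n.+1) :=
  ghom_comp (coind_unit (cosyzygy n.+1)) (gproj (@coind_image_submod (cosyzygy n)) (@coind_image_act _)).

Lemma cobar_d_eq0 n d (v : cobar n d) : ghfun (cobar_d n) d v = 0 <-> coind_image v.
Proof.
have proj0 := gproj_eq0 (@coind_image_submod (cosyzygy n)) (@coind_image_act _) v.
split=> [h|/proj0 h]; last exact: etrans (congr1 (ghfun (coind_unit (cosyzygy n.+1)) d) h) (linear0 _).
apply/proj0.
by apply: (@coind_unit_inj _ _ (cosyzygy n.+1)); rewrite [LHS]h linear0.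
Qed.

Lemma cobar_exact n d (v : cobar n.+1 d) :
  ghfun (cobar_d n.+1) d v = 0 <-> exists u, v = ghfun (cobar_d n) d u.
Proof.
rewrite cobar_d_eq0; split=> [[w ->]|[u ->]].
  have [u ->] := @gproj_surj _ _ (@coind_image_submod (cosyzygy n)) (@coind_image_act _) d w.
  by exists u.
by eexists; reflexivity.
Qed.

(** Both levels are compared on the cobar resolution: from cochains at level N to D/D_{>=N}, down to
    k, and back to cochains at level 1. *)
Lemma acyclic_change N : good pi N -> (forall p, acyclic N X p) -> forall p, acyclic 1 X p.
Proof.
move=> gN acX p; have cobar_ri n : rel_injective (cobar n) by exact: coind_rel_injective.
have aug := @acyclic_augmentation X cobar (coind_unit X) cobar_d
  (@coind_unit_inj _ _ X) (@cobar_d_eq0 0).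
apply/aug; apply: killed_exact_acyclic => //; first exact: cobar_exact; first exact: good1.
apply: (killed_exact1 cobar_ri cobar_exact (proj1 gN)).
apply: acyclic_killed_exact => //; first exact: cobar_exact.
by move=> p'; apply/aug.
Qed.
End Cobar.
End GradedSubquotient.

(** * Acyclicity of extended modules *)

Section Limits.
Variables (k : comPzRingType) (pi : nat -> k) (N : nat) (X : gmod k pi).

(* A complete filtration of the cochains: cocycles up to [Fil r.+1] are coboundaries
   up to [Fil r], and the successive primitives can be corrected so as to converge. *)
Lemma acyclic_limit (Fil : nat -> forall e, seq nat -> X e -> Prop) :
  (forall r e s (u v : X e), Fil r e s u -> Fil r e s v -> Fil r e s (u - v)) ->
  (forall r e s, Fil r e s (0 : X e)) ->
  (forall r e s (v : X e), Fil r.+1 e s v -> Fil r e s v) ->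
  (forall e s (v : X e), (forall r, Fil r e s v) -> v = 0) ->
  (forall e s (a : nat -> X e), (forall r, Fil r e s (a r.+1 - a r)) ->
    exists L, forall r, Fil r e s (L - a r)) ->
  (forall r e s, exists2 r', (r <= r')%N & forall h : cochain X,
    (forall e' s', (size s').+1 = size s -> Fil r' e' s' (h e' s')) ->
    Fil r e s (delta N h e s)) ->
  (forall p r (f : cochain X),
    (forall e s, size s = p.+1 -> Fil r.+1 e s (delta N f e s)) ->
    exists g, forall e s, size s = p -> Fil r e s (f e s - delta N g e s)) ->
  forall p, acyclic N X p.
Proof.
move=> FilB Fil0 FilS Fil_sep Fil_lim Fil_cont approx p f fcocycle.
have Fil_le r r' e s (v : X e) : (r <= r')%N -> Fil r' e s v -> Fil r e s v.
  by move=> /subnK <-; elim: (r' - r)%N => [//|i IHi]; rewrite addSn => /FilS.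
have approx_f r : exists g, forall e s, size s = p -> Fil r e s (f e s - delta N g e s).
  by apply: approx => e s /fcocycle ->.
case: p f fcocycle approx_f => [|p] f fcocycle approx_f.
  exists f => e [_|//]; apply: (Fil_sep e [::]) => r.
  by have [g /(_ e [::] erefl)] := approx_f r; rewrite /= !subr0.
pose Q r (g : cochain X) := forall e s, size s = p.+1 -> Fil r.+1 e s (f e s - delta N g e s).
have step r g : exists g', Q r g -> Q r.+1 g' /\
    forall e s, size s = p -> Fil r e s (g' e s - g e s).
  have [Qg|nQ] := pselect (Q r g); last by exists g.
  (* The better primitive g1 differs from g by a cocycle up to [Fil r.+1]; subtracting some
     [delta t] brings it close to g without changing its coboundary. *)
  have [g1 g1f] := approx_f r.+2.
  have [|t gt] := approx p r (fun e s => g1 e s - g e s).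
    move=> e s ss; rewrite deltaB.
    have -> : delta N g1 e s - delta N g e s =
      (f e s - delta N g e s) - (f e s - delta N g1 e s).
      by rewrite opprB [RHS]addrC addrA subrK.
    by apply: FilB; [exact: Qg | apply: FilS; exact: g1f].
  exists (fun e s => g1 e s - delta N t e s) => _; split=> [e s ss|e s ss].
    by rewrite deltaB delta_delta subr0; exact: g1f.
  by rewrite addrAC; exact: gt.
pose next r g := projT1 (cid (step r g)).
have nextP r g : Q r g -> Q r.+1 (next r g) /\
    forall e s, size s = p -> Fil r e s (next r g e s - g e s).
  by rewrite /next; case: (cid _).
have [g0 Q0] := approx_f 1%N.
pose G := fix G r := if r is r'.+1 then next r' (G r') else g0.
have QG r : Q r (G r) by elim: r => [//|r /nextP[]].
have lim e s : exists L, size s = p -> forall r, Fil r e s (L - G r e s).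
  have [sp|nsp] := pselect (size s = p); last by exists 0.
  have [|L hL] := Fil_lim e s (fun r => G r e s); last by exists L.
  by move=> r; have [_] := nextP _ _ (QG r); apply.
exists (fun e s => projT1 (cid (lim e s))) => e s ss.
set L : cochain X := fun e s => _.
have LG e' s' : size s' = p -> forall r, Fil r e' s' (L e' s' - G r e' s').
  by rewrite /L; case: (cid _) => ? /=; apply.
apply/eqP; rewrite -subr_eq0; apply/eqP/(Fil_sep e s) => r.
have [r' rr' cont] := Fil_cont r e s.
have -> : f e s - delta N L e s =
    (f e s - delta N (G r') e s) - delta N (fun e s => L e s - G r' e s) e s.
  by rewrite deltaB opprB addrA subrK.
apply: FilB; first by apply: Fil_le (QG r' e s ss); lia.
by apply: cont => e' s'; rewrite ss => -[s'p]; exact: LG.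
Qed.
End Limits.

Section Extended.
Variables (k : comPzRingType) (pi : nat -> k) (N : nat) (X : gmod k pi) (e0 : int).
Local Notation cc := (cc pi).

(* [v b] is the coefficient of x^[bN] in a presentation of X as an extended module
   over the span of the x^[bN]. *)
Variable v : forall (b : nat) (e : int), {linear X e -> X (e - (b * N)%N%:Z)}.
Hypothesis X_bounded : forall e (x : X e), e < e0 -> x = 0.
Hypothesis v_decomp : forall e (x : X e) B, e - (B * N)%N%:Z < e0 ->
  x = \sum_(b < B) gact X (e - (b * N)%N%:Z) e (v b e x).
Hypothesis v_act : forall e f b q (x : X (e - (q * N)%N%:Z)), (q <= b)%N ->
  gact X _ f (v b e (gact X (e - (q * N)%N%:Z) e x)) =
  cc ((b - q) * N) (q * N) *: gact X _ f (v (b - q) _ x).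

Section Level.
(* [m] and [n] stand for the degrees mN and nN. *)
Variables m n : nat.
Hypothesis n_gt0 : (0 < n)%N.
Hypothesis mn : (m <= n)%N.

(** Duality within the block of n consecutive indices containing b: x^[bN] and x^[gap b * N]
    multiply to a unit multiple of x^[top b * N]. *)
Let top b := (b %/ n * n + n.-1)%N.
Let gap b := (n.-1 - b %% n)%N.

Hypothesis unit_gap : forall b, invertible (cc (b * N) (gap b * N)).
Hypothesis cross0 : forall b q, (q < m)%N -> (b %/ n != (b + q) %/ n)%N ->
  forall e (x : X e), cc (b * N) (q * N) *: x = 0.

Let gap_lt b : (gap b < n)%N.
Proof. by rewrite /gap; lia. Qed.

Let gap_top b : (b + gap b = top b)%N.
Proof.
rewrite /gap /top {1}(divn_eq b n); have := ltn_pmod b n_gt0; nodiv_lia.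
Qed.

(** Recovers the component at x^[bN] from the coefficient of x^[top b * N] in the value of c at
    x^[gap b * N]. *)
Definition coinduced_term e (c : family X) b : X e :=
  let d := e + (gap b * N)%N%:Z in
  recip (cc (b * N) (gap b * N)) *: gact X _ e (v (top b) d (c d (gap b))).

(* Multiplication by x^[qN] identifies X in each degree with the product, over q < n, of
   the pieces spanned by the x^[bN] with b = -1 modulo n. *)
Definition coinduced_ret e (c : family X) : X e :=
  \sum_(b < (absz (e - e0)).+1) coinduced_term e c b.

Lemma coinduced_term_big e c b : e - (b * N)%N%:Z < e0 -> coinduced_term e c b = 0.
Proof.
move=> eb; rewrite /coinduced_term (X_bounded (v _ _ _)) ?linear0 ?scaler0 //.
by rewrite -gap_top; lia.
Qed.

Hypothesis N_gt0 : (0 < N)%N.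

Lemma coinduced_retE e c B : (absz (e - e0) < B)%N ->
  coinduced_ret e c = \sum_(0 <= b < B) coinduced_term e c b.
Proof.
move=> eB; rewrite (@big_cat_nat _ _ _ (absz (e - e0)).+1) //= [X in _ + X]big_nat_cond.
rewrite [X in _ + X]big1 ?addr0 ?big_mkord // => b /andP[/andP[eb _] _].
apply: coinduced_term_big; have : (b <= b * N)%N by rewrite leq_pmulr.
by move: (b * N)%N => bN; lia.
Qed.

Lemma coinduced_ret_lin e a (c c' : family X) :
  coinduced_ret e (fun d p => a *: c d p - c' d p) = a *: coinduced_ret e c - coinduced_ret e c'.
Proof.
rewrite /coinduced_ret scaler_sumr -sumrB; apply: eq_bigr => b _.
rewrite /coinduced_term linearB /= linearB /= [v _ _ (a *: _)]linearZ_LR /=.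
by rewrite [gact X _ _ (a *: _)]linearZ_LR /= scalerBr !scalerA mulrC.
Qed.

Lemma coinduced_ret_loc e (c c' : family X) :
  (forall p, (p < n)%N -> c (e + (p * N)%N%:Z) p = c' (e + (p * N)%N%:Z) p) ->
  coinduced_ret e c = coinduced_ret e c'.
Proof.
by move=> cc'; apply: eq_bigr => b _; rewrite /coinduced_term cc' // gap_lt.
Qed.

(** By [v_act] the term of index b is x^[bN] times the coefficient [v b] of x, and [v_decomp] adds
    these up. *)
Lemma coinduced_ret_unit e (x : forall e, X e) :
  coinduced_ret e (fun d p => gact X (d - (p * N)%N%:Z) d (x (d - (p * N)%N%:Z))) = x e.
Proof.
rewrite [RHS](@v_decomp _ _ (absz (e - e0)).+1); last first.
  have : ((absz (e - e0)).+1 <= (absz (e - e0)).+1 * N)%N by rewrite leq_pmulr.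
  by move: (_ * N)%N => bN; lia.
apply: eq_bigr => b _; rewrite /coinduced_term v_act -gap_top ?leq_addl // addnK.
rewrite scalerA recipK // scale1r.
by have -> : e + (gap b * N)%N%:Z - (gap b * N)%N%:Z = e by lia.
Qed.

(** The term b on the left matches the term b + q on the right. If both indices lie in one block,
    the scalars agree by associativity; otherwise both terms vanish by [cross0]. *)
Lemma coinduced_ret_equiv e q (c : family X) : (q < m)%N ->
  gact X (e - (q * N)%N%:Z) e (coinduced_ret (e - (q * N)%N%:Z) c) =
  coinduced_ret e (fun d p => cc (p * N) (q * N) *: c d (p + q)%N).
Proof.
move=> qm; set e1 := e - _.
pose c' : family X := fun d p => cc (p * N) (q * N) *: c d (p + q)%N.
rewrite -/c'; pose B := (absz (e - e0) + absz (e1 - e0)).+1.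
rewrite (@coinduced_retE e1 _ B) ?(@coinduced_retE e _ (B + q)); try by rewrite /B; lia.
(* Here gap b + q >= n, so the scalar in c' crosses a multiple of n. *)
have crossing b : (b %% n < q)%N -> coinduced_term e c' b = 0.
  move=> bq; rewrite /coinduced_term /c' cross0 ?linear0 ?linear0 ?scaler0 //.
  rewrite divn_small ?gap_lt // eq_sym -lt0n divn_gt0 // /gap; lia.
rewrite [RHS](@big_cat_nat _ _ _ q) //=; last by lia.
rewrite [X in _ = X + _]big_nat_cond [X in _ = X + _]big1 ?add0r; last first.
  move=> b /andP[/andP[_ bq] _]; apply: crossing.
  exact: leq_ltn_trans (leq_mod _ _) bq.
have -> : \sum_(q <= b < B + q) coinduced_term e c' b = \sum_(0 <= b < B) coinduced_term e c' (b + q).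
  by rewrite -{1}[q]add0n big_addn addnK.
rewrite linear_sum; apply: eq_bigr => b _ /=.
rewrite {1}/coinduced_term linearZ_LR /= (gact_ccn (a := b * N) (b := q * N)); last first.
- by rewrite /e1 subrK.
- by rewrite -gap_top mulnDl PoszD; lia.
have [same|diff] := eqVneq (b %/ n)%N ((b + q) %/ n)%N; last first.
  rewrite [cc (q * N) _]ccC cross0 // scaler0 crossing //.
  have : (b %/ n < (b + q) %/ n)%N by rewrite ltn_neqAle diff leq_div2r // leq_addr.
  rewrite ltn_divLR // => bz; have := divn_eq (b + q) n; move: bz.
  by move: (_ %/ _ * n)%N (_ %% _)%N => zn r; lia.
have gapE : gap b = (gap (b + q) + q)%N.
  have := gap_top b; have := gap_top (b + q); rewrite /top -same.
  by move: (gap b) (gap (b + q)) (_ %/ _ * _ + _)%N => x y z; lia.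
have topE : top (b + q) = top b by rewrite /top same.
have := unit_gap b; have := unit_gap (b + q).
rewrite /coinduced_term /c' topE gapE; move: (gap (b + q)) => g u1 u2.
have -> : e1 + ((g + q) * N)%N%:Z = e + (g * N)%N%:Z.
  by rewrite /e1 mulnDl PoszD; lia.
rewrite [v _ _ (_ *: _)]linearZ_LR /= [gact X _ _ (_ *: v _ _ _)]linearZ_LR /= !scalerA; congr (_ *: _).
rewrite [LHS]mulrC; apply: recip_swap => //.
rewrite mulrC !mulnDl [(g * N + _)%N]addnC [cc (q * N) _]ccC [cc (g * N) _]ccC.
exact: cc_assoc.
Qed.

Lemma level_primitive (f : cochain X) e q1 q : (q1.+1 < m)%N ->
  (forall p, (p.+1 < n)%N -> delta N f (e + (p.+1 * N)%N%:Z) [:: p, q1 & q] = 0) ->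
  f e (q1 :: q) = delta N (contraction coinduced_ret f) e (q1 :: q).
Proof.
apply: (@contractionP _ _ _ X (fun p => (p < n)%N) (fun q => (q < m)%N)).
- exact: coinduced_ret_lin.
- exact: coinduced_ret_loc.
- exact: coinduced_ret_unit.
- exact: coinduced_ret_equiv.
Qed.

(** In [coinduced_ret_unit] only terms with gap b = 0 survive; then b >= n - 1, and these vanish for
    degree reasons. *)
Lemma level_zero (x : forall e, X e) e : e - (n.-1 * N)%N%:Z < e0 ->
  (forall p, (p.+1 < n)%N -> gact X e (e + (p.+1 * N)%N%:Z) (x e) = 0) -> x e = 0.
Proof.
move=> en x0; rewrite -[LHS](coinduced_ret_unit e x).
rewrite (coinduced_ret_loc (c' := fun d p => if p is 0 then x d else 0)); last first.
  move=> [_|p pn]; first by rewrite (gact_self x) ?subr0.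
  by rewrite (@gact_index _ _ X _ e _ x) ?x0 ?addrK.
rewrite /coinduced_ret big1 // => b _.
have [b0|] := posnP (gap b); last first.
  by rewrite /coinduced_term; case: (gap b) => // g _; rewrite !linear0 ?scaler0.
apply: coinduced_term_big; apply: le_lt_trans en; rewrite lerD2l lerN2 lez_nat leq_mul2r.
by apply/orP; right; have := gap_top b; rewrite b0 addn0 => ->; exact: leq_addl.
Qed.
End Level.

(* The levels [nn r] tend to infinity; up to degree about [nn r * N], X looks like a
   coinduced module. *)
Variable nn : nat -> nat.
Hypothesis N_gt0 : (0 < N)%N.
Hypothesis nn_gt0 : forall r, (0 < nn r)%N.
Hypothesis nn_lt : forall r, (nn r < nn r.+1)%N.
Hypothesis unit_gap : forall r b,
  invertible (cc (b * N) (((nn r).-1 - b %% nn r) * N)).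
Hypothesis cross0 : forall r b q, (q < nn r)%N ->
  (b %/ nn r.+1 != (b + q) %/ nn r.+1)%N ->
  forall e (x : X e), cc (b * N) (q * N) *: x = 0.

(** The brackets on which level r gives a valid homotopy: the first entry is short enough and the
    source degree is less than [((nn r).-1) * N] above e0. *)
Let reach r e (s : seq nat) :=
  (if s is q :: _ then q.+1 < nn r else true)%N && (e - (total s * N)%N%:Z - ((nn r).-1 * N)%N%:Z < e0).

Let nn_le r r' : (r <= r')%N -> (nn r <= nn r')%N.
Proof. by move=> /subnK <-; elim: (r' - r)%N => [//|i IHi]; rewrite addSn (leq_trans IHi) // ltnW. Qed.

Let nn_ge r : (r <= nn r)%N.
Proof. by elim: r => [//|r IHr]; apply: leq_ltn_trans IHr (nn_lt r). Qed.

Let reach_le r r' e s : (r <= r')%N -> reach r e s -> reach r' e s.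
Proof.
move=> /nn_le rr' /andP[hs he]; apply/andP; split.
  by case: s hs {he} => // q s /leq_trans; apply.
apply: le_lt_trans he; rewrite lerD2l lerN2 lez_nat leq_mul2r.
by apply/orP; right; rewrite -!subn1 leq_sub2r.
Qed.

Let reach_all e t : exists r, forall e' s, (total s <= t)%N ->
  e' - (total s * N)%N%:Z = e - (t * N)%N%:Z -> reach r e' s.
Proof.
exists (absz (e - e0) + t).+2 => e' s st es; apply/andP; split.
  case: s st {es} => // q s; rewrite /total /= => st.
  by apply: leq_trans (nn_ge _); lia.
have : ((absz (e - e0) + t).+1 <= (nn (absz (e - e0) + t).+2).-1)%N.
  by rewrite -ltnS prednK // nn_ge.
rewrite es -(leq_pmul2r N_gt0).
have : (absz (e - e0) < (absz (e - e0) + t).+1 * N)%N.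
  by apply: leq_trans (leq_pmulr _ N_gt0); lia.
by move: (_.+1 * N)%N (_.-1 * N)%N (t * N)%N => x y z; lia.
Qed.

(** The filtration consists of cochains vanishing within reach. Every bracket is eventually reached,
    so convergent sequences become stationary. *)
Lemma extended_acyclic p : acyclic N X p.
Proof.
move: p; apply: (@acyclic_limit _ _ _ X (fun r e s x => reach r e s -> x = 0)).
- by move=> r e s x y hx hy hr; rewrite hx ?hy ?subr0.
- by [].
- by move=> r e s x hx hr; apply: hx; apply: reach_le hr.
- move=> e s x hx; have [r hr] := reach_all e (total s).
  by apply: (hx r); apply: hr.
- move=> e s a ha; have [r0 hr0] := reach_all e (total s).
  have {}hr0 : reach r0 e s by apply: hr0.
  have const r r' : (r <= r')%N -> reach r e s -> a r' = a r.
    move=> /subnK <- hr; elim: (r' - r)%N => [//|i IHi].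
    apply/eqP; rewrite addSn -subr_eq0 -IHi ha //.
    by apply: reach_le hr; rewrite leq_addl.
  exists (a r0) => r hr; case: (leqP r r0) => [rr0|/ltnW r0r].
    by rewrite (const r r0) // subrr.
  by rewrite (const r0 r) // subrr.
- move=> r e s; have [r0 hr0] := reach_all e (total s).
  exists (maxn r r0) => [|h h0 _]; first exact: leq_maxl.
  apply: etrans (@delta0 _ pi N _ e s).
  apply: delta_ext_total => e' s' ss ts es; apply: h0 => //.
  by apply: reach_le (hr0 _ _ ts es); exact: leq_maxr.
move=> p r f fcocycle.
have cross r' := cross0 (r := r').
case: p fcocycle => [|p] fcocycle.
  exists f => e [_|//] /andP[_ he]; rewrite /= subr0.
  apply: (@level_zero (nn r) (nn r.+1) (nn_gt0 _) (ltnW (nn_lt r)) (unit_gap r.+1) N_gt0 (fun e => f e [::])).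
    apply: le_lt_trans he; rewrite /total /= mul0n subr0 lerD2l lerN2 lez_nat leq_mul2r.
    by apply/orP; right; rewrite -!subn1 leq_sub2r // ltnW.
  move=> q qn; have := fcocycle (e + (q.+1 * N)%N%:Z) [:: q] erefl.
  rewrite /= subr0 addrK => -> //; apply/andP; split=> //.
  rewrite /total /= addn1 !addn0 addrK; apply: le_lt_trans he.
  rewrite /total /= mul0n subr0 lerD2l lerN2 lez_nat leq_mul2r.
  by apply/orP; right; rewrite -!subn1 leq_sub2r // ltnW.
exists (contraction (coinduced_ret (nn r.+1)) f) => e [//|q1 q] [sq] /andP[hq he].
apply/eqP; rewrite subr_eq0; apply/eqP.
apply: (@level_primitive (nn r) (nn r.+1)) => //; first exact: ltnW.
  exact: cross.
(* The identities that are read have first entry below [nn r.+1], hence the loss of one step in the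
   filtration. *)
move=> p' p'n; apply: fcocycle; first by rewrite /= sq.
apply/andP; split=> //; apply: le_lt_trans he.
have -> : total [:: p', q1 & q] = (total (q1 :: q) + p'.+1)%N by rewrite /total /=; lia.
have : ((nn r).-1 * N <= (nn r.+1).-1 * N)%N.
  by rewrite leq_mul2r -!subn1 leq_sub2r ?orbT // ltnW.
by rewrite mulnDl; move: (_ * N)%N (_ * N)%N (_ * N)%N (_ * N)%N => x y z w; lia.
Qed.
End Extended.

(** * Krull's intersection theorem *)

Section Krull.
Variables (k : comPzRingType) (V : lmodType k).

Definition span r (x : 'I_r -> V) (u : V) := exists c : 'I_r -> k, u = \sum_i c i *: x i.

Lemma span_submod r (x : 'I_r -> V) : is_submod (span x).
Proof.
split=> [|a _ _ [c ->] [d ->]].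
  by exists (fun _ => 0); rewrite big1 // => i _; rewrite scale0r.
exists (fun i => a * c i + d i); rewrite scaler_sumr -big_split; apply: eq_bigr => i _.
by rewrite scalerDl scalerA.
Qed.

Lemma span_sub r (x : 'I_r -> V) (S : V -> Prop) : is_submod S -> (forall i, S (x i)) ->
  forall u, span x u -> S u.
Proof. by move=> hS Sx u [c ->]; apply: submod_sum => // i _; apply: submodZ. Qed.

Definition fg_submod (S : V -> Prop) :=
  exists s (y : 'I_s -> V), (forall i, S (y i)) /\ forall u, S u -> span y u.

(** Induction on the number of generators: J is the ideal of coefficients of the first generator
    occurring in S, and S' is the part of S spanned by the others. *)
Lemma submodule_fg r (x : 'I_r -> V) (S : V -> Prop) : noetherian k -> is_submod S ->
  (forall u, S u -> span x u) -> fg_submod S.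
Proof.
move=> noeth; elim: r x S => [|r IHr] x S hS Sx.
  exists 0%N, (fun _ => 0); split=> [[]//|u /Sx[c ->]].
  by exists (fun _ => 0); rewrite !big_ord0.
set x' := fun i => x (lift ord0 i); have hx' := span_submod x'.
pose J a := exists2 u, S u & span x' (u - a *: x ord0).
have [|m [g gJ]] := noeth J.
  split.
  - by exists 0; [exact: (proj1 hS) | rewrite scale0r subr0; exact: (proj1 hx')].
  - move=> a b [u Su ux] [w Sw wx]; exists (u + w); first exact: submodD.
    by rewrite scalerDl opprD addrACA; apply: submodD.
  - move=> a b [u Su ux]; exists (a *: u); first exact: submodZ.
    by rewrite -scalerA -scalerBr; apply: submodZ.
have Jg j : exists u, S u /\ span x' (u - g j *: x ord0).
  suff [u Su ux] : J (g j) by exists u.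
  apply/gJ; exists (fun i => (i == j)%:R); rewrite (bigD1 j) //= eqxx mul1r big1 ?addr0 //.
  by move=> i /negPf ->; rewrite mul0r.
have [w wP] := choice Jg.
pose S' u := S u /\ span x' u.
have [||s [y [yS' y_gen]]] := IHr x' S'; last 1 first.
- exists (m + s)%N, (fun i => match split i with inl i => w i | inr i => y i end); split.
    by move=> i; case: (split i) => j; [case: (wP j) | case: (yS' j)].
  move=> u Su; have [c uE] := Sx u Su; rewrite big_ord_recl in uE.
  have [d cd] : exists d : 'I_m -> k, c ord0 = \sum_i d i * g i.
    apply/gJ; exists u => //; rewrite uE addrAC subrr add0r.
    by exists (fun i => c (lift ord0 i)).
  have [|d2 d2E] := y_gen (u - \sum_i d i *: w i).
    split; first by apply: submodB => //; apply: submod_sum => // i _; apply: submodZ => //; case: (wP i).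
    have -> : u - \sum_i d i *: w i = (u - c ord0 *: x ord0) - \sum_i d i *: (w i - g i *: x ord0).
      have -> : \sum_i d i *: (w i - g i *: x ord0) = \sum_i d i *: w i - c ord0 *: x ord0.
        by rewrite cd scaler_suml -sumrB; apply: eq_bigr => i _; rewrite scalerBr scalerA.
      by rewrite opprB addrA subrK.
    apply: submodB => //; last by apply: submod_sum => // i _; apply: submodZ => //; case: (wP i).
    by rewrite uE addrAC subrr add0r; exists (fun i => c (lift ord0 i)).
  exists (fun i => match split i with inl i => d i | inr i => d2 i end).
  rewrite big_split_ord /= -[LHS](subrK (\sum_i d i *: w i)) d2E [LHS]addrC.
  congr (_ + _); apply: eq_bigr => i _.
    by case: splitP => j /= ij; [rewrite (val_inj ij) | have := ltn_ord i; lia].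
  by case: splitP => j /= ij; [have := ltn_ord j; lia | have -> : i = j by apply: val_inj => /=; lia].
- split=> [|a u u' [Su xu] [Su' xu']]; first by split; [exact: (proj1 hS) | exact: (proj1 hx')].
  by split; [apply: (proj2 hS) | apply: (proj2 hx')].
- by move=> u [].
Qed.

Hypothesis noeth : noetherian k.
Variables (r : nat) (x : 'I_r -> V).
Hypothesis x_gen : forall u, span x u.

Lemma submodule_acc (S : nat -> V -> Prop) : (forall n, is_submod (S n)) ->
  (forall n u, S n u -> S n.+1 u) -> exists n, forall u, S n.+1 u -> S n u.
Proof.
move=> hS SS; have S_le n m u : (n <= m)%N -> S n u -> S m u.
  by move=> /subnK <- Sn; elim: (m - n)%N => // i; rewrite addSn; exact: SS.
have [||s [y [yS y_gen]]] := @submodule_fg r x (fun u => exists n, S n u) noeth.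
- split=> [|a u w [n Sn] [m Sm]]; first by exists 0%N; exact: (proj1 (hS _)).
  exists (maxn n m); apply: (proj2 (hS _)).
    by apply: S_le Sn; exact: leq_maxl.
  by apply: S_le Sm; exact: leq_maxr.
- by move=> u _.
have [n nS] := choice yS; exists (\max_i n i) => u Su.
apply: (span_sub (hS _) _ (y_gen u _)); last by exists (\max_i n i).+1.
by move=> i; apply: S_le (nS i); exact: leq_bigmax.
Qed.

Variable I : k -> Prop.
Hypothesis idI : is_ideal I.

Definition pow_smul n u := exists m (a : 'I_m -> k) (y : 'I_m -> V),
  (forall i, ideal_pow I n (a i)) /\ u = \sum_i a i *: y i.

Lemma pow_smul_gen n u : pow_smul n u <->
  exists2 c : 'I_r -> k, (forall i, ideal_pow I n (c i)) & u = \sum_i c i *: x i.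
Proof.
split=> [[m [a [y [aI ->]]]]|[c cI ->]]; last by exists r, c, x.
have [d dE] := choice (fun i => x_gen (y i)).
exists (fun j => \sum_i a i * d i j) => [j|].
  by apply: ideal_pow_sum => // i _; rewrite mulrC; apply: ideal_powM.
rewrite (eq_bigr (fun i => \sum_j (a i * d i j) *: x j)); last first.
  by move=> i _; rewrite {1}dE scaler_sumr; apply: eq_bigr => j _; rewrite scalerA.
by rewrite exchange_big; apply: eq_bigr => j _; rewrite scaler_suml.
Qed.

(** The differences lift to coefficients in I^n on the generators, and the coefficients converge in
    k. *)
Lemma pow_smul_complete : adically_complete I -> forall a : nat -> V,
  (forall n, pow_smul n (a n.+1 - a n)) -> exists L, forall n, pow_smul n (L - a n).
Proof.
move=> [_ complI] a ha; have [c0 c0E] := x_gen (a 0%N).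
have D n : exists c : 'I_r -> k, (forall i, ideal_pow I n (c i)) /\
    a n.+1 - a n = \sum_i c i *: x i.
  by have /pow_smul_gen[c cI cE] := ha n; exists c.
have [d dP] := choice D.
pose C n i := c0 i + \sum_(j < n) d j i.
have aE n : a n = \sum_i C n i *: x i.
  elim: n => [|n IHn].
    by rewrite c0E; apply: eq_bigr => i _; rewrite /C big_ord0 addr0.
  rewrite -[LHS](subrK (a n)) (proj2 (dP n)) {}IHn -big_split; apply: eq_bigr => i _ /=.
  by rewrite /C big_ord_recr /= addrA [RHS]scalerDl addrC.
have lim i : exists L, forall n, ideal_pow I n (L - C n i).
  apply: complI => n; rewrite /C big_ord_recr /= addrA [X in X - _]addrC addrK.
  by case: (dP n).
have [L hL] := choice lim; exists (\sum_i L i *: x i) => n.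
rewrite aE -sumrB; apply/pow_smul_gen; exists (fun i => L i - C n i) => //.
by apply: eq_bigr => i _; rewrite scalerBl.
Qed.

(* The Artin-Rees step of Krull's theorem: [K] meets the line of [v] inside [I v], and
   K + a^n V still does once the submodules (K : a^n) have stabilised. *)
Lemma krull_step (v : V) (K : V -> Prop) a : is_submod K -> I a ->
  (forall b, I b -> K (b *: v)) ->
  (forall b, K (b *: v) -> exists2 i, I i & b *: v = i *: v) ->
  exists n (K' : V -> Prop), [/\ is_submod K', forall u, K u -> K' u,
    forall u, K' (a ^+ n *: u) &
    forall b, K' (b *: v) -> exists2 i, I i & b *: v = i *: v].
Proof.
move=> hK Ia KI Kv.
have [||n stable] := @submodule_acc (fun n u => K (a ^+ n *: u)).
- move=> n; split=> [|b u w Ku Kw]; first by rewrite scaler0; exact: (proj1 hK).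
  by rewrite scalerDr scalerA mulrC -scalerA; apply: (proj2 hK).
- by move=> n u Ku; rewrite exprS -scalerA; apply: submodZ.
exists n, (fun u => exists w, K (u - a ^+ n *: w)); split.
- split=> [|b u w [u' Ku] [w' Kw]]; first by exists 0; rewrite scaler0 subr0; exact: (proj1 hK).
  exists (b *: u' + w'); rewrite scalerDr scalerA [_ * b]mulrC -scalerA opprD addrACA -scalerBr.
  exact: (proj2 hK).
- by move=> u Ku; exists 0; rewrite scaler0 subr0.
- by move=> u; exists u; rewrite subrr; exact: (proj1 hK).
(* Since a b is in I, a b v lies in K; so a^(n+1) w does, then a^n w by stability, and finally b
   v. *)
move=> b [w Kw]; apply: Kv; rewrite -(subrK (a ^+ n *: w) (b *: v)).
apply: submodD => //; apply: stable; rewrite exprS -scalerA.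
have -> : a *: (a ^+ n *: w) = (a * b) *: v - a *: (b *: v - a ^+ n *: w).
  by rewrite -[(a * b) *: v]scalerA scalerBr opprB addrC subrK.
apply: submodB => //; last exact: submodZ.
by apply: KI; rewrite mulrC; case: idI => _ _; apply.
Qed.

(** Starting from K = I v, one step for each g_i puts a power of g_i times V into K. *)
Lemma krull_submod (v : V) m (g : 'I_m -> k) : (forall i, I (g i)) ->
  exists (K : V -> Prop) B, [/\ is_submod K, forall i u, K (g i ^+ B *: u) &
    forall b, K (b *: v) -> exists2 i, I i & b *: v = i *: v].
Proof.
move=> Ig.
suff [K [hK Kg Kv]] : exists K : V -> Prop, [/\ is_submod K,
    forall i, i \in enum 'I_m -> exists n, forall u, K (g i ^+ n *: u) &
    forall b, K (b *: v) -> exists2 i, I i & b *: v = i *: v].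
  have [B KB] := choice (fun i => Kg i (mem_enum _ i)).
  exists K, (\max_i B i); split=> // i u.
  by rewrite -(subnK (leq_bigmax i)) exprD -scalerA; apply: submodZ.
suff [K [hK Kg KI Kv]] : exists K : V -> Prop, [/\ is_submod K,
    forall i, i \in enum 'I_m -> exists n, forall u, K (g i ^+ n *: u),
    forall b, I b -> K (b *: v) &
    forall b, K (b *: v) -> exists2 i, I i & b *: v = i *: v] by exists K.
elim: (enum 'I_m) => [|j s [K [hK Kg KI Kv]]].
  exists (fun u => exists2 i, I i & u = i *: v); split=> //.
    split=> [|a _ _ [i Ii ->] [j Ij ->]].
      by exists 0; [case: idI | rewrite scale0r].
    exists (a * i + j); last by rewrite scalerDl scalerA.
    by case: idI => _ addI mulI; apply: addI => //; exact: mulI.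
  by move=> b Ib; exists b.
have [n [K' [hK' KK' K'g K'v]]] := krull_step hK (Ig j) KI Kv.
exists K'; split=> // [i|b /KI/KK'] //.
rewrite inE => /orP[/eqP ->|/Kg[n' hn']]; first by exists n.
by exists n' => u; apply: KK'.
Qed.

(* Pigeonhole principle; [e] records the exponents already collected. *)
Lemma ideal_pow_pigeonhole m (g : 'I_m -> k) (K : k -> Prop) B n x0 (e : 'I_m -> nat) :
  (forall a, I a -> exists c : 'I_m -> k, a = \sum_i c i * g i) ->
  is_ideal K -> (forall i, K (g i ^+ B)) -> (\sum_i (B - e i) < n)%N ->
  ideal_pow I n x0 -> K (x0 * \prod_i g i ^+ e i).
Proof.
move=> gI [K0 KD KM] Kg.
have Ksum q (F : 'I_q -> k) : (forall i, K (F i)) -> K (\sum_i F i).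
  by move=> KF; elim/big_ind: _.
elim: n x0 e => [//|n IHn] x0 e en [q [a [b [ab ->]]]].
rewrite mulr_suml; apply: (Ksum) => j.
have [Ia Ib] := ab j; have [c ->] := gI _ Ia.
rewrite !mulr_suml; apply: (Ksum) => i.
rewrite -!mulrA; apply: (KM (c i)).
case: (leqP B (e i)) => Be.
  rewrite (bigD1 i) //= -(subnK Be) exprD.
  have -> : g i * (b j * (g i ^+ (e i - B) * g i ^+ B * \prod_(i0 < m | i0 != i) g i0 ^+ e i0)) =
    (g i * b j * g i ^+ (e i - B) * \prod_(i0 < m | i0 != i) g i0 ^+ e i0) * g i ^+ B by ring.
  exact: KM.
have -> : g i * (b j * \prod_i0 g i0 ^+ e i0) =
    b j * \prod_i0 g i0 ^+ (if i0 == i then (e i0).+1 else e i0).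
  rewrite [in LHS](bigD1 i) //= [in RHS](bigD1 i) //= eqxx exprS.
  rewrite [X in _ = _ * (_ * X)](eq_bigr (fun i0 => g i0 ^+ e i0)); last by move=> i0 /negPf ->.
  by ring.
apply: IHn => //; move: en; rewrite (bigD1 i) //= [in X in _ -> X](bigD1 i) //= eqxx.
rewrite [X in _ -> (_ + X < _)%N](eq_bigr (fun i0 => (B - e i0)%N)); last by move=> i0 /negPf ->.
by lia.
Qed.

(** By the pigeonhole lemma K contains I^n V for n > m B; hence v = i v with i in I, and 1 - i is a
    unit. *)
Lemma pow_smul_separated (v : V) : adically_complete I -> (forall n, pow_smul n v) -> v = 0.
Proof.
move=> complI hv; have [m [g gI]] := noeth idI.
have Ig i : I (g i).
  apply/gI; exists (fun j => (j == i)%:R); rewrite (bigD1 i) //= eqxx mul1r big1 ?addr0 //.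
  by move=> j /negPf ->; rewrite mul0r.
have [K [B [hK Kg Kv]]] := krull_submod v Ig.
have {hv}[q [a [y [aI vE]]]] := hv (\sum_(i < m) (B - 0)).+1%N.
have : K (1 *: v).
  rewrite scale1r vE; apply: (submod_sum hK) => i _.
  have := @ideal_pow_pigeonhole m g (fun b => forall u, K (b *: u)) B _ (a i) (fun _ => 0%N)
    (fun a => proj1 (gI a)) _ Kg (ltnSn _) (aI i).
  rewrite big1 ?mulr1 => [|j _]; last by rewrite expr0.
  apply; split=> [u|b c hb hc u|b c hc u].
  - by rewrite scale0r; exact: (proj1 hK).
  - by rewrite scalerDl; apply: submodD.
  - by rewrite -scalerA; apply: submodZ.
move=> /Kv[i Ii iv].
apply: invertible_cancel (invertible_sub_ideal idI complI Ii) _.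
by rewrite scalerBl iv subrr.
Qed.
End Krull.

(** * Finitely presented modules modulo powers of the ideal *)

Section AdicQuotient.
Variables (k : comPzRingType) (pi : nat -> k) (I : k -> Prop).
Hypothesis idI : is_ideal I.

Lemma pow_smul_submod (V : lmodType k) n : is_submod (@pow_smul k V I n).
Proof.
split=> [|a _ _ [m [b [y [bI ->]]]] [m' [b' [y' [bI' ->]]]]].
  by exists 0%N, (fun _ => 0), (fun _ => 0); split=> [[]//|]; rewrite big_ord0.
exists (m + m')%N, (fun i => match split i with inl i => a * b i | inr i => b' i end),
  (fun i => match split i with inl i => y i | inr i => y' i end); split.
  by move=> i; case: (split i) => j //; apply: ideal_powM.
rewrite scaler_sumr big_split_ord /=; congr (_ + _); apply: eq_bigr => i _.
- by case: splitP => j /= ij; [rewrite scalerA (val_inj ij) | have := ltn_ord i; lia].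
- by case: splitP => j /= ij; [have := ltn_ord j; lia | have -> : i = j by apply: val_inj => /=; lia].
Qed.

Lemma pow_smul_map (V W : lmodType k) (phi : {linear V -> W}) n u :
  pow_smul I n u -> pow_smul I n (phi u).
Proof.
move=> [m [a [y [aI ->]]]]; exists m, a, (fun i => phi (y i)); split=> //.
by rewrite linear_sum; apply: eq_bigr => i _; rewrite linearZ_LR.
Qed.

Lemma pow_smulZ (V : lmodType k) n a (u : V) : ideal_pow I n a -> pow_smul I n (a *: u).
Proof. by move=> aI; exists 1%N, (fun _ => a), (fun _ => u); split=> //; rewrite big_ord1. Qed.

Lemma pow_smul_pred (V : lmodType k) n (u : V) : pow_smul I n.+1 u -> pow_smul I n u.
Proof.
move=> [m [a [y [aI ->]]]]; exists m, a, y; split=> // i.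
by apply: ideal_pow_pred.
Qed.

Section Quotient.
Variables (X : gmod k pi) (n : nat).

Lemma adic_act d e (v : X d) : pow_smul I n v -> pow_smul I n (gact X d e v).
Proof. exact: pow_smul_map. Qed.

Definition adic_quot := gquot (fun d => pow_smul_submod (X d) n) adic_act.
Definition adic_proj : ghom X adic_quot := gproj (fun d => pow_smul_submod (X d) n) adic_act.

Lemma adic_proj_eq0 d (v : X d) : ghfun adic_proj d v = 0 <-> pow_smul I n v.
Proof. exact: gproj_eq0. Qed.

Lemma adic_proj_surj d (w : adic_quot d) : exists v, w = ghfun adic_proj d v.
Proof. exact: gproj_surj. Qed.

Lemma adic_quot_ideal_pow d a (w : adic_quot d) : ideal_pow I n a -> a *: w = 0.
Proof.
move=> aI; have [v ->] := adic_proj_surj w; rewrite -linearZ_LR.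
by apply/adic_proj_eq0; exact: pow_smulZ.
Qed.
End Quotient.

(** A cocycle modulo I^(r+1) is a cocycle in X/I^r X; lifting its primitive gives the approximation
    needed for [acyclic_limit]. *)
Lemma acyclic_adic (X : gmod k pi) N :
  (forall d (v : X d), (forall n, pow_smul I n v) -> v = 0) ->
  (forall d (a : nat -> X d), (forall n, pow_smul I n (a n.+1 - a n)) ->
    exists L, forall n, pow_smul I n (L - a n)) ->
  (forall n p, acyclic N (adic_quot X n) p) -> forall p, acyclic N X p.
Proof.
move=> sep compl acX; have S e n := pow_smul_submod (X e) n.
apply: (@acyclic_limit _ _ _ X (fun r e s x => pow_smul I r x)).
- by move=> r e s u v hu hv; apply: (submodB (S e r)).
- by move=> r e s; exact: (proj1 (S e r)).
- by move=> r e s v; exact: pow_smul_pred.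
- by move=> e s v; exact: sep.
- by move=> e s a; exact: compl.
- move=> r e s; exists r => // h hh.
  apply/adic_proj_eq0; rewrite delta_ghom.
  apply: etrans (@delta0 _ pi N _ e s).
  by apply: delta_ext_total => e' s' ss _ _; apply/adic_proj_eq0; exact: hh.
move=> p r f fcocycle.
have [e s ss|g fg] := acX r p (fun e s => ghfun (adic_proj X r) e (f e s)).
  by rewrite -delta_ghom; apply/adic_proj_eq0/pow_smul_pred/fcocycle.
have [e s _|g' g'g] := @choose_family _ _ _ _ (adic_proj X r) (fun _ => True) g.
  exact: adic_proj_surj.
exists g' => e s ss; apply/adic_proj_eq0.
have projB : {morph ghfun (adic_proj X r) e : u v / u - v} by exact: linearB.
rewrite projB fg // delta_ghom.
apply/eqP; rewrite subr_eq0; apply/eqP.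
by apply: delta_ext_total => e' s' _ _ _; rewrite g'g.
Qed.
End AdicQuotient.

Section FinitelyPresented.
Variables (k : comPzRingType) (pi : nat -> k) (I : k -> Prop) (M : gmod k pi).
Hypothesis idI : is_ideal I.
Local Notation cc := (cc pi).

Variables (r : nat) (deg : 'I_r -> int) (g : forall j, M (deg j)).
Hypothesis g_gen : forall e (v : M e), exists c : 'I_r -> k,
  v = \sum_(j < r) c j *: gact M (deg j) e (g j).
Variables (s : nat) (fdeg : 'I_s -> int) (rho : 'I_s -> 'I_r -> k).
Hypothesis rho_rel : forall l, \sum_(j < r) rho l j *: gact M (deg j) (fdeg l) (g j) = 0.
Hypothesis rho_gen : forall e (c : 'I_r -> k), (forall j, e < deg j -> c j = 0) ->
  \sum_(j < r) c j *: gact M (deg j) e (g j) = 0 ->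
  exists b : 'I_s -> k, forall j, c j = \sum_(l < s | (deg j <= fdeg l) && (fdeg l <= e))
    b l * rho l j * xcoef pi (deg j) (fdeg l) e.

Variables (n N : nat) (levels : seq nat).
Hypothesis goodN : good pi N.
Hypothesis levels_uniq : uniq levels.
Hypothesis levels_size : size levels = n.
Hypothesis levelsP : forall a, a \in levels -> [/\ (1 < a)%N, I (pi a), (a %| N)%N &
  forall l j, (absz (fdeg l - deg j) < a)%N].

Definition comb e (c : 'I_r -> k) : M e := \sum_j c j *: gact M (deg j) e (g j).

Definition slice_coef b e (c : 'I_r -> k) j : k :=
  if (deg j <= e) && (absz (e - deg j) %/ N == b)%N
  then recip (cc (b * N) (absz (e - deg j) %% N)) * c j else 0.

(* The part of c whose coordinates c_j x^[e - deg j] satisfy floor((e - deg j)/N) = b,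
   divided by x^[bN]. *)
Definition slice b e c := comb (e - (b * N)%N%:Z) (slice_coef b e c).

Lemma comb_lin e a c c' : comb e (fun j => a * c j + c' j) = a *: comb e c + comb e c'.
Proof.
rewrite /comb scaler_sumr -big_split; apply: eq_bigr => j _.
by rewrite scalerDl scalerA.
Qed.

Lemma slice_lin b e a c c' : slice b e (fun j => a * c j + c' j) = a *: slice b e c + slice b e c'.
Proof.
rewrite /slice -comb_lin; apply: eq_bigr => j _; congr (_ *: _).
by rewrite /slice_coef; case: ifP => _; [ring | rewrite mulr0 addr0].
Qed.

Let t l j := absz (fdeg l - deg j).

Lemma crossing_ideal a l j : (a %/ N != (a + t l j) %/ N)%N -> ideal_pow I n (cc a (t l j)).
Proof.
move=> cross; rewrite -levels_size; apply: cc_crossing cross => //.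
by move=> a' /levelsP[a1 Ia aN ta]; split=> //; exact: ta.
Qed.

(** Write e - fdeg l = qN + a with a < N. For b <> q, every coordinate in the slice has crossed a
    multiple of N; for b = q, the slice is a unit times x^[a] times the relation, up to crossing
    coordinates. *)
Lemma slice_relation b e l : fdeg l <= e ->
  pow_smul I n (\sum_(j | deg j <= fdeg l)
    slice_coef b e (fun j => rho l j * xcoef pi (deg j) (fdeg l) e) j *:
      gact M (deg j) (e - (b * N)%N%:Z) (g j)).
Proof.
move=> le; set u := absz (e - fdeg l); set f := e - (b * N)%N%:Z.
have hS := pow_smul_submod idI (M f) n.
have [ub|nub] := eqVneq (u %/ N)%N b; last first.
  apply: (submod_sum hS) => j jl; rewrite /slice_coef; case: ifP => [/andP[je jb]|_]; last first.
    by rewrite scale0r; exact: (proj1 hS).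
  apply: pow_smulZ; apply: (ideal_powM idI); apply: (ideal_powM idI).
  rewrite xcoefE //; apply: crossing_ideal.
  by rewrite (_ : (_ + _)%N = absz (e - deg j)) ?(eqP jb) // /t; lia.
have uE : u = (b * N + u %% N)%N by rewrite {1}(divn_eq u N) ub.
have := ltn_pmod u (proj1 goodN); move: uE; set a := (u %% N)%N => uE aN.
have fE : f = fdeg l + a%:Z by move: uE; rewrite /f; move: (b * N)%N => bN; rewrite /u; lia.
(* The expected slice, a multiple of the relation and so of sum zero; it is subtracted coordinate by
   coordinate. *)
pose T j := recip (cc (b * N) a) *: gact M (fdeg l) f (rho l j *: gact M (deg j) (fdeg l) (g j)).
have T0 : \sum_(j | deg j <= fdeg l) T j = 0.
  rewrite -scaler_sumr -linear_sum /= (_ : \sum_(j | _) _ = 0) ?linear0 ?scaler0 //.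
  rewrite -[RHS](rho_rel l) [RHS](bigID (fun j => deg j <= fdeg l)) /= [X in _ = _ + X]big1 ?addr0 //.
  by move=> j; rewrite -ltNge => jl; rewrite gact_neg // scaler0.
set A := \sum_(j | _) _; have -> : A = A - \sum_(j | deg j <= fdeg l) T j by rewrite T0 subr0.
rewrite {}/A -sumrB; apply: (submod_sum hS) => j jl.
have tE : fdeg l = deg j + (t l j)%:Z by rewrite /t; lia.
have -> : T j = (recip (cc (b * N) a) * rho l j * cc a (t l j)) *: gact M (deg j) f (g j).
  by rewrite /T linearZ_LR /= (gact_ccn _ tE fE) !scalerA.
have je : absz (e - deg j) = (b * N + (a + t l j))%N.
  by move: uE; rewrite /u /t; move: (b * N)%N => bN; lia.
have jle : deg j <= e by exact: le_trans le.
rewrite /slice_coef jle /= je divnMDl ?(proj1 goodN) // -{2}[b]addn0 eqn_add2l.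
rewrite modnMDl xcoefE // -/u -/(t l j).
have [small|] := eqVneq ((a + t l j) %/ N)%N 0%N; last first.
  move=> big; rewrite scale0r sub0r -scaleNr; apply: pow_smulZ; rewrite -mulrN.
  by apply: (ideal_powM idI); apply: (ideal_powN idI); apply: crossing_ideal; rewrite divn_small // eq_sym.
have atN : (a + t l j < N)%N.
  by rewrite ltnNge; apply/negP => h; move: small; apply/eqP; rewrite -lt0n divn_gt0 // (proj1 goodN).
rewrite modn_small //.
rewrite -scalerBl (_ : _ - _ = 0) ?scale0r; first exact: (proj1 hS).
apply/eqP; rewrite subr_eq0; apply/eqP.
have E : cc u (t l j) * recip (cc (b * N) (a + t l j)) = recip (cc (b * N) a) * cc a (t l j).
  by rewrite uE; apply: recip_swap; [exact: good_cc_invertible.. | exact: cc_assoc].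
transitivity (rho l j * (cc u (t l j) * recip (cc (b * N) (a + t l j)))); first by ring.
by rewrite E; ring.
Qed.


Lemma slice_coefE b e c c' j : (deg j <= e -> c j = c' j) ->
  slice_coef b e c j = slice_coef b e c' j.
Proof. by rewrite /slice_coef; case: ifP => // /andP[je _] ->. Qed.

(** Up to coefficients in I^n, coordinates of an element of I^n M combine multiples of the
    relations, whose slices are known. *)
Lemma slice_adic b e c : pow_smul I n (comb e c) -> pow_smul I n (slice b e c).
Proof.
move=> /(pow_smul_gen (fun u => g_gen u) idI)[c' c'I cc'].
have hS := pow_smul_submod idI (M (e - (b * N)%N%:Z)) n.
pose d j := if deg j <= e then c j - c' j else 0.
have [j ej||w wE] := @rho_gen e d.
- by rewrite /d ifN // -ltNge.
- transitivity (comb e c - comb e c); last exact: subrr.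
  rewrite {2}cc' /comb -sumrB; apply: eq_bigr => j _; rewrite -scalerBl /d.
  by case: ifP => // /negbT; rewrite -ltNge => je; rewrite gact_neg // !scaler0.
have -> : slice b e c = slice b e (fun j => 1 * d j + c' j).
  apply: eq_bigr => j _; congr (_ *: _); apply: slice_coefE => je.
  by rewrite /d je mul1r subrK.
rewrite slice_lin scale1r; apply: (submodD hS); last first.
  apply: (submod_sum hS) => j _; apply: pow_smulZ; rewrite /slice_coef.
  by case: ifP => _; [exact: ideal_powM | exact: ideal_pow0].
pose R l j := slice_coef b e (fun j => rho l j * xcoef pi (deg j) (fdeg l) e) j.
have -> : slice b e d = \sum_(l | fdeg l <= e) w l *:
    \sum_(j | deg j <= fdeg l) R l j *: gact M (deg j) (e - (b * N)%N%:Z) (g j).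
  under eq_bigr do rewrite scaler_sumr.
  rewrite (exchange_big_dep xpredT) //=; apply: eq_bigr => j _.
  transitivity (\sum_(l | (fdeg l <= e) && (deg j <= fdeg l))
      (w l * R l j) *: gact M (deg j) (e - (b * N)%N%:Z) (g j)); last first.
    by apply: eq_bigr => l _; rewrite scalerA.
  rewrite -scaler_suml; congr (_ *: _); rewrite /R /slice_coef wE.
  case: ifP => _; last by rewrite big1 // => l _; rewrite mulr0.
  rewrite mulr_sumr; apply: eq_big => [l|l _]; first exact: andbC.
  by ring.
by apply: (submod_sum hS) => l le; apply: (submodZ hS); exact: slice_relation.
Qed.

Lemma gact_comb q e c : gact M (e - (q * N)%N%:Z) e (comb (e - (q * N)%N%:Z) c) =
  comb e (fun j => if deg j <= e - (q * N)%N%:Z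
    then c j * cc (q * N) (absz (e - (q * N)%N%:Z - deg j)%R) else 0).
Proof.
rewrite linear_sum; apply: eq_bigr => j _ /=; rewrite linearZ_LR /=.
case: ifP => [je|/negbT]; last first.
  by rewrite -ltNge => je; rewrite (gact_neg _ _ M _ _ (g j) je) linear0 scaler0 scale0r.
rewrite (gact_ccn (a := absz (e - (q * N)%N%:Z - deg j)%R) (b := q * N)) ?scalerA //; lia.
Qed.

Lemma slice_decomp e0 e c B : (forall j, e0 <= deg j) -> e - (B * N)%N%:Z < e0 ->
  \sum_(b < B) gact M (e - (b * N)%N%:Z) e (slice b e c) = comb e c.
Proof.
move=> e0deg eB; have N0 := proj1 goodN.
transitivity (\sum_(b < B) \sum_j slice_coef b e c j *:
    gact M (e - (b * N)%N%:Z) e (gact M (deg j) (e - (b * N)%N%:Z) (g j))).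
  apply: eq_bigr => b _; rewrite linear_sum; apply: eq_bigr => j _ /=.
  by rewrite linearZ_LR.
rewrite exchange_big; apply: eq_bigr => j _ /=.
have [je|ej] := lerP (deg j) e; last first.
  rewrite gact_neg // scaler0 big1 // => b _.
  by rewrite /slice_coef leNgt ej scale0r.
have b0B : (absz (e - deg j) %/ N < B)%N.
  by rewrite ltn_divLR //; have := e0deg j; move: eB; move: (B * N)%N => BN; lia.
rewrite (bigD1 (Ordinal b0B)) //= [X in _ + X]big1 ?addr0; last first.
  move=> b bb0; rewrite /slice_coef; case: ifP => [/andP[_ /eqP jb]|_]; last exact: scale0r.
  by case/eqP: bb0; apply: val_inj; rewrite /= jb.
rewrite /slice_coef je eqxx /=.
have := divn_eq (absz (e - deg j)) N; have := ltn_pmod (absz (e - deg j)) N0.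
move: (_ %/ _)%N (_ %% _)%N => b a aN bE.
rewrite (gact_ccn (a := a) (b := b * N)); last 2 first.
- by move: bE; move: (b * N)%N => bN; lia.
- by rewrite subrK.
by rewrite scalerA mulrAC recipK ?mul1r //; exact: good_cc_invertible.
Qed.

Let X := adic_quot idI M n.
Let proj : ghom M X := adic_proj idI M n.

Let coordP e (x : X e) : exists c, x = ghfun proj e (comb e c).
Proof.
have [u ->] := adic_proj_surj x; have [c ->] := g_gen u.
by exists c.
Qed.

(** Coordinates are chosen arbitrarily; [slice_adic] makes the result independent of them. *)
Definition slice_quot b e (x : X e) : X (e - (b * N)%N%:Z) :=
  ghfun proj (e - (b * N)%N%:Z) (slice b e (projT1 (cid (coordP x)))).

Let projB e : {morph ghfun proj e : u v / u - v}.
Proof. exact: linearB. Qed.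

Let slice_quotE b e c :
  slice_quot b (ghfun proj e (comb e c)) = ghfun proj (e - (b * N)%N%:Z) (slice b e c).
Proof.
rewrite /slice_quot; case: (cid _) => c' /[dup] /esym c'E ?; rewrite [projT1 _]/=.
apply/eqP; rewrite -subr_eq0 -projB; apply/eqP/adic_proj_eq0.
have E (f : int) (F : ('I_r -> k) -> M f) :
    (forall a c c', F (fun j => a * c j + c' j) = a *: F c + F c') ->
    F c' - F c = F (fun j => (- 1) * c j + c' j).
  by move=> ->; rewrite scaleN1r addrC.
rewrite E; last by move=> *; exact: slice_lin.
apply: slice_adic; rewrite -(E _ (comb e)); last by move=> *; exact: comb_lin.
apply/adic_proj_eq0; rewrite -/X -/proj projB; apply/eqP; rewrite subr_eq0; apply/eqP; exact: c'E.
Qed.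

Fact slice_quot_lin b e a (x y : X e) :
  slice_quot b (a *: x + y) = a *: slice_quot b x + slice_quot b y.
Proof.
have [c ->] := coordP x; have [d ->] := coordP y.
by rewrite -ghlin -comb_lin !slice_quotE slice_lin ghlin.
Qed.
HB.instance Definition _ b e := GRing.isLinear.Build k (X e) (X (e - (b * N)%N%:Z)) *:%R
  (@slice_quot b e) (@slice_quot_lin b e).

(** Multiplication by x^[qN] adds q to each quotient by N and keeps the remainder; the scalars match
    by associativity. *)
Lemma slice_quot_act e f b q (x : X (e - (q * N)%N%:Z)) : (q <= b)%N ->
  gact X _ f (slice_quot b (gact X (e - (q * N)%N%:Z) e x)) =
  cc ((b - q) * N) (q * N) *: gact X _ f (slice_quot (b - q) x).
Proof.
move=> qb; have [c ->] := coordP x; rewrite -ghcomm gact_comb !slice_quotE -!ghcomm.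
rewrite -linearZ_LR /=; congr (quot_pi _ _).
rewrite /slice (_ : e - (q * N)%N%:Z - ((b - q) * N)%N%:Z = e - (b * N)%N%:Z); last first.
  by rewrite -{2}(subnK qb) mulnDl PoszD opprD addrA addrAC.
rewrite -linearZ_LR /=; congr (gact M _ _ _).
rewrite /comb scaler_sumr; apply: eq_bigr => j _; rewrite scalerA; congr (_ *: _).
rewrite /slice_coef; have [je|ej] := lerP (deg j) (e - (q * N)%N%:Z); last first.
  by rewrite mulr0 mulr0 if_same.
have -> : deg j <= e by apply: le_trans je _; lia.
have -> : absz (e - deg j) = (absz (e - (q * N)%N%:Z - deg j)%R + q * N)%N by lia.
rewrite divnDMl ?(proj1 goodN) // (addnC _ (q * N)%N) modnMDl.
rewrite -[X in (_ == X)]/b -{1}(subnK qb) eqn_add2r.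
have := divn_eq (absz (e - (q * N)%N%:Z - deg j)%R) N.
have := ltn_pmod (absz (e - (q * N)%N%:Z - deg j)%R) (proj1 goodN).
move: (_ %/ _)%N (_ %% _)%N => b' a aN; case: eqP => [->|_ _]; last by rewrite /= mulr0.
move=> uE; rewrite /= uE.
have E : cc (q * N) ((b - q) * N + a) * recip (cc (b * N) a) =
    recip (cc ((b - q) * N) a) * cc ((b - q) * N) (q * N).
  apply: recip_swap; try exact: good_cc_invertible.
  rewrite -cc_assoc [cc (q * N) _]ccC; congr (cc _ _ * _).
  by rewrite -mulnDl subnKC.
transitivity (c j * (cc (q * N) ((b - q) * N + a) * recip (cc (b * N) a))); first by ring.
by rewrite E; ring.
Qed.

Lemma finitely_presented_acyclic (nn : nat -> nat) p :
  (forall m, (0 < nn m)%N) -> (forall m, (nn m < nn m.+1)%N) ->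
  (forall m b, invertible (cc (b * N) (((nn m).-1 - b %% nn m) * N))) ->
  (forall m b q, (q < nn m)%N -> (b %/ nn m.+1 != (b + q) %/ nn m.+1)%N ->
    ideal_pow I n (cc (b * N) (q * N))) ->
  acyclic N X p.
Proof.
move=> nn0 nnS unit_gap cross.
pose e0 : int := - (\sum_j absz (deg j))%N%:Z.
have e0deg j : e0 <= deg j.
  have : (absz (deg j) <= \sum_j absz (deg j))%N by rewrite (bigD1 j) //= leq_addr.
  by rewrite /e0; move: (\sum_j _)%N => S; lia.
apply: (@extended_acyclic _ _ N X e0 (fun b e => @slice_quot b e) _ _ _ nn) => //.
- move=> e x ee0; have [c ->] := coordP x; rewrite /comb big1 ?linear0 // => j _.
  by rewrite gact_neg ?scaler0 //; exact: lt_le_trans (e0deg j).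
- move=> e x B eB; have [c ->] := coordP x.
  rewrite -{1}(slice_decomp c e0deg eB) linear_sum; apply: eq_bigr => b _.
  exact: etrans (ghcomm _ _ _ _ proj _ _ _) (congr1 (gact X _ e) (esym (slice_quotE b e c))).
- by move=> e f b q x; exact: slice_quot_act.
- exact: (proj1 goodN).
by move=> m b q qm bq e x; apply: adic_quot_ideal_pow; exact: cross bq.
Qed.
End FinitelyPresented.

(** * Choice of the levels *)

Section Levels.
Variables (k : comPzRingType) (pi : nat -> k) (I : k -> Prop).
Hypotheses (idI : is_ideal I) (complI : adically_complete I) (adm : admissible pi).
Hypothesis k_nontrivial : (1 : k) <> 0.
Hypothesis infI : forall N : nat, exists n, (N <= n)%N /\ I (pi n).

Definition level n := (1 < n)%N /\ I (pi n).

Lemma level_good n : level n -> good pi n.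
Proof.
move=> [n1 In]; split=> [|j j1]; first exact: ltnW.
have [[a [b ab]]|nab] := pselect (exists a b : k, a * pi n + b * pi j = 1).
  constructor 1; have [|y yE] := @invertible_sub_ideal _ I idI complI (a * pi n).
    by case: idI => _ _; apply.
  by exists (y * b); rewrite -mulrA -yE -ab addrAC subrr add0r.
have /orP[nj|jn] := proj2 adm n j (ltnW n1) (ltnW j1) nab; first by constructor 3.
by constructor 2.
Qed.

Lemma level_chain a b : level a -> level b -> (a <= b)%N -> (a %| b)%N.
Proof.
move=> [a1 Ia] [b1 Ib] ab.
have [[x [y xy]]|nab] := pselect (exists x y : k, x * pi a + y * pi b = 1).
  have [_ addI mulI] := idI.
  have [|z] := @invertible_sub_ideal _ I idI complI 1.
    by rewrite -xy; apply: addI; apply: mulI.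
  by rewrite subrr mulr0 => /esym.
have /orP[//|ba] := proj2 adm a b (ltnW a1) (ltnW b1) nab.
by have := dvdn_leq (ltnW a1) ba; move=> ?; rewrite (_ : a = b) //; lia.
Qed.

Lemma levels_above m c : exists n s, [/\ level n, (m < n)%N, uniq s, size s = c &
  forall j, j \in s -> [/\ (1 < j)%N, I (pi j), (j %| n)%N & (m < j)%N]].
Proof.
elim: c => [|c [n [s [ln mn us sc hs]]]].
  have [n [mn In]] := infI (maxn m 1).+1; exists n, [::]; split=> //; last first.
    by apply: leq_trans mn; rewrite ltnS leq_maxl.
  by split=> //; apply: leq_trans mn; rewrite ltnS leq_maxr.
have [n' [nn' In']] := infI n.+1.
have ln' : level n' by split=> //; apply: ltn_trans nn'; case: ln.
have dn : (n %| n')%N by apply: level_chain => //; exact: ltnW.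
exists n', (n' :: s); split=> //=; first exact: ltn_trans nn'.
- rewrite us andbT; apply/negP => /hs[_ _ n'n _].
  by have := dvdn_leq (ltnW (proj1 ln)) n'n; rewrite leqNgt nn'.
- by rewrite sc.
move=> j; rewrite inE => /orP[/eqP ->|/hs[j1 Ij jn mj]].
  by split; [case: ln' | case: ln' | | exact: ltn_trans nn'].
by split=> //; exact: dvdn_trans dn.
Qed.

(** No non-unit pi_j carries. This is clear if j divides N; otherwise j = j' N, and modulo j' the
    residues of b and n - 1 - (b mod n) sum to j' - 1 if j' divides n, and to at most j' - 1 if n
    divides j'. *)
Lemma good_gap_invertible N n b : good pi N -> good pi (n * N) -> (0 < n)%N ->
  invertible (cc pi (b * N) ((n.-1 - b %% n) * N)).
Proof.
move=> [N0 gN] [_ gnN] n0; apply: cc_invertible => j j1 ej.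
case: (gN j j1) => // [jN|/dvdnP[j' jE]].
  by move: ej; rewrite eps_dvd ?dvdn_mull.
have j'0 : (0 < j')%N by case: (j') jE => [|//]; lia.
case: (gnN j j1) => // nj; case/negP: ej; apply/eqP/eps_mod; rewrite ?jE ?muln_gt0 ?j'0 //.
  rewrite -!muln_modl -mulnDl ltn_pmul2r //.
  move: nj; rewrite jE dvdn_pmul2r // => /dvdnP[w nE].
  have := ltn_pmod b n0; have := ltn_pmod b j'0; set g := (n.-1 - b %% n)%N.
  have : ((b %% n) %% j' = b %% j')%N by rewrite nE modn_dvdm // dvdn_mull.
  have -> : (g = (w * j').-1 - b %% n)%N by rewrite /g -nE.
  have := divn_eq (b %% n) j'; move: (b %% n)%N (b %% j')%N => R R' RE RR' R'j Rn.
  move: RE; rewrite RR'; move: (R %/ j')%N => z RE.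
  have zw : (z < w)%N by rewrite -(ltn_pmul2r j'0) -nE; apply: leq_ltn_trans Rn; rewrite RE leq_addr.
  have -> : ((w * j').-1 - R = (w - z).-1 * j' + (j'.-1 - R'))%N.
    have : ((w - z).-1 * j' = w * j' - z * j' - j')%N by rewrite -subn1 !mulnBl mul1n.
    have : (z * j' + j' <= w * j')%N by rewrite -mulSnr leq_mul2r zw orbT.
    by rewrite RE; move: (z * j')%N (w * j')%N (_.-1 * j')%N => x y u; lia.
  by rewrite modnMDl modn_small; lia.
rewrite -!muln_modl; have [q qE] := dvdnP nj.
have {qE} qE : j' = (q * n)%N.
  by apply/eqP; rewrite -(eqn_pmul2r N0) -jE qE mulnA.
have q0 : (0 < q)%N by case: (q) qE j'0 => // ->.
rewrite -mulnDl ltn_pmul2r // [X in (_ + X < _)%N]modn_small; last first.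
  rewrite qE; apply: leq_ltn_trans (leq_subr _ _) _.
  by apply: leq_trans (_ : (n <= _)%N); [rewrite prednK | rewrite leq_pmull].
have := ltn_pmod b n0; have := ltn_pmod b j'0.
have : ((b %% j') %% n = b %% n)%N by rewrite qE modn_dvdm // dvdn_mull.
have := divn_eq (b %% j') n; move: (b %% j')%N (b %% n)%N => R R' RE RR' Rj R'n.
move: RE; rewrite RR'; move: (R %/ n)%N => z RE.
have zq : (z < q)%N by rewrite -(ltn_pmul2r n0) -qE; apply: leq_ltn_trans Rj; rewrite RE leq_addr.
have : (z * n + n <= q * n)%N by rewrite -mulSnr leq_mul2r zq orbT.
by rewrite RE qE; move: (z * n)%N (q * n)%N => x y; lia.
Qed.

(** For each power n, take a level N divisible by n levels longer than all relations, then a chain a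
    i of levels above N such that n levels exceeding a i divide a (i+1). *)
Lemma finitely_presented_acyclic1 (M : gmod k pi) p : noetherian k -> gfin_pres M ->
  acyclic 1 M p.
Proof.
move=> noeth [r [deg [g [g_gen [s [fdeg [rho [rho_rel rho_gen]]]]]]]].
move: p; apply: (acyclic_adic (idI := idI)).
- move=> d v; exact: (pow_smul_separated noeth (fun u => g_gen d u) idI complI).
- move=> d a; exact: (pow_smul_complete (fun u => g_gen d u) idI complI).
move=> n; pose D := (\sum_l \sum_j absz (fdeg l - deg j))%N.
have [N [ls [lN DN uls sls hls]]] := levels_above D n.
have step m : exists n', (m < n')%N /\ level n' /\ exists s, [/\ uniq s, size s = n &
    forall j, j \in s -> [/\ (1 < j)%N, I (pi j), (j %| n')%N & (m < j)%N]].
  by have [n' [s' [ln' mn' us' ss' hs']]] := levels_above m n; exists n'; do 2!split=> //; exists s'.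
have [next nextP] := choice step.
pose a i := iter i next N.
have aS i : (a i < a i.+1)%N by case: (nextP (a i)).
have aL i : level (a i) by case: i => // i; case: (nextP (a i)) => _ [].
have aN i : (N <= a i)%N by elim: i => // i IHi; apply: leq_trans IHi _; exact: ltnW.
have Na i : (N %| a i)%N by exact: level_chain.
have N0 : (0 < N)%N by case: lN => /ltnW.
have aE i : a i = (a i %/ N * N)%N by rewrite divnK.
apply: (acyclic_change (level_good lN)) => p.
apply: (finitely_presented_acyclic (idI := idI) g_gen (fun l => proj2 (rho_rel l)) rho_gen (level_good lN)
  uls sls _ (nn := fun i => (a i %/ N)%N)).
- move=> j jls; have [j1 Ij jN Dj] := hls j jls; split=> // l i.
  by apply: leq_ltn_trans Dj; rewrite /D (bigD1 l) //= (bigD1 i) //= -addnA leq_addr.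
- by move=> i; rewrite divn_gt0.
- by move=> i; rewrite -(ltn_pmul2r N0) -!aE.
- move=> i b; apply: good_gap_invertible; first exact: level_good.
    by rewrite -aE; exact: level_good.
  by rewrite divn_gt0.
move=> i b q qi cross; have [_ [_ [s' [us' <- hs']]]] := nextP (a i).
apply: (cc_crossing (n := a i.+1) idI us').
  move=> j /hs'[j1 Ij jn aj]; split=> //; apply: leq_ltn_trans aj.
  by rewrite [X in (_ <= X)%N]aE leq_mul2r (ltnW qi) orbT.
by rewrite -mulnDl (aE i.+1) !divnMr.
Qed.
End Levels.

(** * Torsion in injective resolutions *)

Section Torsion.
Variables (k : comPzRingType) (pi : nat -> k).

Definition torsion (X : gmod k pi) d (v : X d) :=
  exists N : nat, forall n, (N <= n)%N -> gact X d (d + n%:Z) v = 0.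

Lemma torsion_submod (X : gmod k pi) d : is_submod (@torsion X d).
Proof.
split=> [|a u v [N uN] [N' vN']]; first by exists 0%N => n _; exact: linear0.
exists (maxn N N') => n; rewrite geq_max => /andP[Nn N'n].
by rewrite gact_add uN // vN' // scaler0 addr0.
Qed.

Lemma torsion_act (X : gmod k pi) d e (v : X d) : torsion v -> torsion (gact X d e v).
Proof.
move=> [N vN]; exists N => n Nn.
have [de|ed] := lerP d e; last by rewrite (gact_neg _ _ X _ _ v ed) linear0.
rewrite gact_cc //; last by lia.
have -> : e + n%:Z = d + (n + absz (e - d))%N%:Z by lia.
by rewrite vN ?scaler0 //; lia.
Qed.

Lemma torsion_hom_shift (T X : gmod k pi) (t : int) (phi : forall d, T (d + t) -> X d) d v :
  gtorsion T -> is_hom_shift phi -> torsion (phi d v).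
Proof.
move=> torT [phi_lin phi_comm]; have [N vN] := torT _ v; exists N => n Nn.
have phi0 e : phi e 0 = 0.
  by have := phi_lin e (- 1) 0 0; rewrite scaler0 addr0 scaleN1r addNr.
rewrite -phi_comm (_ : gact T _ _ v = 0) //.
have -> : d + n%:Z + t = d + t + n%:Z by rewrite addrAC.
exact: vN.
Qed.

Lemma single_family (X : gmod k pi) d (v : X d) :
  exists F : forall e, X e, F d = v /\ forall e, e <> d -> F e = 0.
Proof.
exists (fun e => match @eqP _ d e with
  | ReflectT de => ecast e (X e) de v | ReflectF _ => 0 end); split.
  by case: eqP => // dd; rewrite (eq_irrelevance dd erefl).
by move=> e ed; case: eqP => // de; case: ed.
Qed.

Lemma torsion_killed (X : gmod k pi) d (v : X d) : torsion v ->
  exists j (F : forall e, X e), [/\ killed j.+1 F, F d = v & forall e, e <> d -> F e = 0].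
Proof.
move=> [N vN]; have [F [Fd F0]] := single_family v; exists N, F; split=> // e p Np.
have [edp|/eqP edp] := eqVneq (e - p%:Z) d; last by rewrite F0 ?linear0.
have -> : e = d + p%:Z by lia.
by rewrite (@gact_index _ _ X _ d _ F) ?addrK // Fd vN // ltnW.
Qed.

Lemma killed_torsion (X : gmod k pi) j (F : forall e, X e) d : killed j F -> torsion (F d).
Proof.
move=> Fj; exists j => n jn; have := Fj (d + n%:Z) n jn.
by rewrite (@gact_index _ _ X _ d _ F) // addrK.
Qed.

Variables (M : gmod k pi) (J : nat -> gmod k pi) (e0 : ghom M (J 0%N)).
Variable dd : forall n, ghom (J n) (J n.+1).
Hypothesis res : inj_resolution e0 dd.
Hypothesis acM : forall p, acyclic 1 M p.

Let injJ : forall n, ginjective (J n). Proof. by case: res. Qed.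
Let exactJ n d (v : J n.+1 d) : ghfun (dd n.+1) d v = 0 <-> exists u, v = ghfun (dd n) d u.
Proof. by case: res => _ _ _; apply. Qed.

(** Ext(k, M) is read off on J, then extended to D/D_{>=j+1}. *)
Let killed_exactJ j m : killed_exact dd (@killed k pi j.+1) m.
Proof.
have ri n : rel_injective (J n) by exact: injective_rel_injective.
have [_ e0_inj exact0 _] := res.
apply: (killed_exact_all ri exactJ); apply: (acyclic_killed_exact ri exactJ (good1 pi)) => p.
exact: (proj1 (acyclic_augmentation e0_inj exact0 1 p)).
Qed.

Lemma torsion_cocycle0 d (v : J 0%N d) : torsion v -> ghfun (dd 0%N) d v = 0 -> v = 0.
Proof.
move=> /torsion_killed[j [F [Fj <- F0]]] Fd.
apply: (@killed_exactJ j 0%N F _ Fj) => e.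
by have [->//|/eqP ed] := eqVneq e d; rewrite F0 ?linear0.
Qed.

Lemma torsion_cocycleS n d (v : J n.+1 d) : torsion v -> ghfun (dd n.+1) d v = 0 ->
  exists2 u, torsion u & ghfun (dd n) d u = v.
Proof.
move=> /torsion_killed[j [F [Fj <- F0]]] Fd.
have [|y yj yF] := @killed_exactJ j n.+1 F _ Fj.
  by move=> e; have [->//|/eqP ed] := eqVneq e d; rewrite F0 ?linear0.
by exists (y d); [exact: killed_torsion yj | exact: yF].
Qed.

Let tcycle n d (v : J n d) := torsion v /\ ghfun (dd n) d v = 0.

Let tcycle_submod n d : is_submod (@tcycle n d).
Proof.
split=> [|a u v [tu du] [tv dv]].
  by split; [exact: (proj1 (torsion_submod _ _)) | exact: linear0].
by split; [exact: (proj2 (torsion_submod _ _)) | rewrite ghlin du dv scaler0 addr0].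
Qed.

Let tcycle_act n d e (v : J n d) : tcycle v -> tcycle (gact (J n) d e v).
Proof. by move=> [tv dv]; split; [exact: torsion_act | rewrite ghcomm dv linear0]. Qed.

(* The torsion parts of the J n are injective for torsion modules and form an exact
   complex, so that complex is contractible. *)
Lemma torsion_contraction_step n (R : ghom (J n) (J n)) :
  (forall d (v : J n d), tcycle v -> ghfun R d v = 0) ->
  (forall d v, ghfun (dd n) d (ghfun R d v) = ghfun (dd n) d v) ->
  exists h : ghom (J n.+1) (J n), forall d (v : J n.+1 d), tcycle v ->
    ghfun (dd n) d (ghfun h d v) = v.
Proof.
move=> R0 ddR.
pose A := gsub (@tcycle_submod n.+1) (@tcycle_act n.+1).
pose i : ghom A (J n.+1) := gincl (@tcycle_submod n.+1) (@tcycle_act n.+1).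
have lift d (w : A d) : exists u, torsion u /\ ghfun (dd n) d u = ghfun i d w.
  by have [tw dw] := gsubP w; have [u tu du] := torsion_cocycleS tw dw; exists u.
(* Two torsion primitives differ by a torsion cycle, which R kills, so the choice does not
   matter. *)
pose f d (w : A d) := ghfun R d (projT1 (cid (lift d w))).
have fE d (w : A d) u : torsion u -> ghfun (dd n) d u = ghfun i d w -> f d w = ghfun R d u.
  move=> tu du; rewrite /f; case: (cid _) => u' [tu' du'] /=.
  apply/eqP; rewrite -subr_eq0 -linearB; apply/eqP/R0; split.
    exact: (submodB (torsion_submod _ _)).
  by rewrite linearB /= du du' subrr.
have f_lin d a (w w' : A d) : f d (a *: w + w') = a *: f d w + f d w'.
  have [u [tu du]] := lift d w; have [u' [tu' du']] := lift d w'.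
  rewrite (fE _ _ _ tu du) (fE _ _ _ tu' du') -ghlin; apply: fE.
    exact: (proj2 (torsion_submod _ _)).
  by rewrite !ghlin du du'.
have f_comm d e (w : A d) : f e (gact A d e w) = gact (J n) d e (f d w).
  have [u [tu du]] := lift d w; rewrite (fE _ _ _ tu du) -ghcomm; apply: fE.
    exact: torsion_act.
  by rewrite !ghcomm du.
have [|h hf] := @injJ n A (J n.+1) i (GHom (A := A) (B := J n) f f_lin f_comm); first exact: gincl_inj.
exists h => d v tv; have [w wE] := gsub_ex (@tcycle_submod n.+1) (@tcycle_act n.+1) tv.
have [u [tu du]] := lift d w.
rewrite -wE; have -> := hf d w.
by rewrite /= (fE _ _ _ tu du) ddR du.
Qed.

(** R starts as the identity, since torsion cycles of J 0 vanish, and continues as 1 - dd h with h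
    from the previous step. *)
Lemma torsion_contraction n : exists h : ghom (J n.+1) (J n),
  forall d (v : J n.+1 d), tcycle v -> ghfun (dd n) d (ghfun h d v) = v.
Proof.
suff [R [R0 ddR]] : exists R : ghom (J n) (J n),
    (forall d (v : J n d), tcycle v -> ghfun R d v = 0) /\
    (forall d v, ghfun (dd n) d (ghfun R d v) = ghfun (dd n) d v).
  exact: torsion_contraction_step R0 ddR.
elim: n => [|n [R [R0 ddR]]].
  exists (GHom (A := J 0%N) (B := J 0%N) (fun d v => v) (fun _ _ _ _ => erefl) (fun _ _ _ => erefl)).
  by split=> // d v [tv dv]; exact: torsion_cocycle0.
have [h hK] := torsion_contraction_step R0 ddR.
pose F d (v : J n.+1 d) := v - ghfun (dd n) d (ghfun h d v).
have F_lin d a (u v : J n.+1 d) : F d (a *: u + v) = a *: F d u + F d v.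
  by rewrite /F !ghlin opprD addrACA scalerBr.
have F_comm d e (v : J n.+1 d) : F e (gact (J n.+1) d e v) = gact (J n.+1) d e (F d v).
  by rewrite /F !ghcomm -linearB.
exists (GHom (A := J n.+1) (B := J n.+1) F F_lin F_comm); split=> d v /=.
  by move=> tv; rewrite /F hK // subrr.
rewrite /F linearB /= (_ : ghfun (dd n.+1) d (ghfun (dd n) d _) = 0) ?subr0 //.
by apply/exactJ; eexists.
Qed.
End Torsion.

(** * Vanishing of Ext from torsion modules *)

Theorem theorem8p2 (k : comPzRingType) (pi : nat -> k) (I : k -> Prop)
  (T M : gmod k pi) :
  noetherian k ->
  admissible pi ->
  is_ideal I ->
  adically_complete I ->
  (forall N : nat, exists n : nat, (N <= n)%N /\ I (pi n)) ->
  gfin_pres M ->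
  gtorsion T ->
  forall i : nat, ExtD_zero T M i.
Proof.
move=> noeth adm idI complI infI fpM torT i J e dd res s.
(* Over the zero ring all modules are trivial; the chain of levels requires 1 <> 0. *)
have [k0|k1] := pselect ((1 : k) = 0).
  have trivial (V : lmodType k) (u v : V) : u = v.
    by rewrite -[u]scale1r -[v]scale1r k0 !scale0r.
  case: i => [phi _ _ d v|n phi _ _]; first exact: trivial.
  by exists (fun _ _ => 0); split=> [|d v]; [split=> *; exact: trivial | exact: trivial].
have acM p : acyclic 1 M p by exact: finitely_presented_acyclic1 infI _ _ noeth fpM.
case: i => [phi hphi dphi d v|n phi hphi dphi].
  by apply: (torsion_cocycle0 res acM) => //; exact: torsion_hom_shift.
have [h hK] := torsion_contraction res acM n.
(* [phi] takes values in torsion cycles, on which h is a section of [dd n]. *)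
exists (fun d v => ghfun h d (phi d v)); split.
  have [phi_lin phi_comm] := hphi; split=> [d a u v|d e' v].
    by rewrite phi_lin ghlin.
  by rewrite phi_comm ghcomm.
move=> d v; rewrite hK //; split; last exact: dphi.
exact: torsion_hom_shift.
Qed.
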